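(* Let $\xi\in\mathbb{Z}\setminus\{0\}$ and let $a,b\in\mathbb{Z}$ with $b\neq 0$; put $\Lambda(x)=a-bx$. Let $m\ge 3$ be an integer, and let $\overline{a}_1,\ldots,\overline{a}_{\varphi(m)}$ be the $\varphi(m)$ distinct residue classes of the reduced residue system modulo $m$. Let $r$ be an integer with $r>\frac{\varphi(m)}{2}$ and let $$R=\bigcup_{j=1}^r\left(\overline{a}_{i_j}\cap\mathbb{P}\right)$$ be the union of the primes in any $r$ (distinct) of these residue classes. Then there are infinitely many primes $p\in R$ such that $\Lambda(F_p(\xi))\neq 0$.
   Context: $\mathbb{P}$ denotes the set of all prime numbers and $\varphi$ is Euler's totient function. The reduced residue system modulo $m$ consists of the classes $\{h+km\mid k\in\mathbb{Z}\}$ with $\gcd(h,m)=1$. For a prime $p$, $|\cdot|_p$ is the $p$-adic absolute value normalized by $|p|_p=p^{-1}$, and $\mathbb{Q}_p$ is the completion of $\mathbb{Q}$ with respect to it. For $z\in\mathbb{Q}_p$ with $|z|_p\le 1$ the series $F_p(z):=\sum_{n=0}^\infty n!\,z^n$ (Euler's factorial series) converges in $\mathbb{Q}_p$, and $F_p(z)\in\mathbb{Q}_p$ denotes its sum. *)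

(* Defs.v *)
From HB Require Import structures.
From mathcomp Require Import all_boot all_order all_algebra.
From mathcomp Require Import mathcomp_extra boolp classical_sets functions.
From mathcomp Require Import cardinality topology sequences.
Set Implicit Arguments.
Unset Strict Implicit.
Unset Printing Implicit Defensive.
Import Order.TTheory GRing.Theory Num.Theory.
Local Open Scope classical_set_scope.
Local Open Scope quotient_scope.
Local Open Scope ring_scope.

Definition padic_val (p : nat) (x : rat) : int :=
  (logn p `|numq x|)%:Z - (logn p `|denq x|)%:Z.

(* For p not prime, logn p is 0, so that padic_abs p is the trivial absolute
   value and Qp p below is a copy of rat; this is what makes the construction
   available without a primality proof. *)
Definition padic_abs (p : nat) (x : rat) : rat :=
  if x == 0 then 0 else p%:Q ^ (- padic_val p x).

Section PadicAbs.
Variable p : nat.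
Local Notation "`| x |_p" := (padic_abs p x) (format "`| x |_p").

Lemma padic_val_frac (n d : int) : n != 0 -> d != 0 ->
  padic_val p (n%:Q / d%:Q) = (logn p `|n|)%:Z - (logn p `|d|)%:Z.
Proof.
move=> n0 d0; rewrite /padic_val; set x : rat := n%:Q / d%:Q.
have d0' : d%:Q != 0 :> rat by rewrite intr_eq0.
have x0 : x != 0 by rewrite /x mulf_neq0 ?invr_eq0 ?intr_eq0.
have e : numq x * d = n * denq x.
  apply: (intr_inj (R := rat)); rewrite !intrM.
  have ed : (denq x)%:~R != 0 :> rat by rewrite intr_eq0 denq_neq0.
  have -> : (numq x)%:~R = x * (denq x)%:~R :> rat.
    by rewrite -[X in X * _](divq_num_den x) divfK.
  by rewrite mulrAC /x divfK.
have := congr1 (fun z : int => logn p `|z|%N) e.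
rewrite !abszM !lognM ?absz_gt0 ?numq_eq0 ?denq_neq0// => /(congr1 Posz).
rewrite !PoszD => E; apply/eqP; rewrite subr_eq addrAC -E addrK; exact: eqxx.
Qed.

Lemma padic_val_int (n : int) : padic_val p n%:~R = (logn p `|n|)%:Z.
Proof. by rewrite /padic_val numq_int denq_int absz1 logn1 subr0. Qed.

Lemma padic_val_nonprime : ~~ prime p -> forall x, padic_val p x = 0.
Proof. by move=> /negbTE np x; rewrite /padic_val /logn np. Qed.

Lemma padic_abs0 : `|0|_p = 0. Proof. by rewrite /padic_abs eqxx. Qed.

Lemma padic_abs_gt0 x : x != 0 -> 0 < `|x|_p.
Proof.
move=> x0; rewrite /padic_abs (negbTE x0).
have [pp|np] := boolP (prime p).
  by rewrite exprz_gt0// ltr0n prime_gt0.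
by rewrite padic_val_nonprime.
Qed.

Lemma padic_abs_ge0 x : 0 <= `|x|_p.
Proof.
by have [->|/padic_abs_gt0/ltW//] := eqVneq x 0; rewrite padic_abs0.
Qed.

Lemma padic_abs_eq0 x : (`|x|_p == 0) = (x == 0).
Proof.
apply/eqP/eqP => [|->]; last exact: padic_abs0.
by apply: contra_eq => /padic_abs_gt0; rewrite lt0r => /andP[].
Qed.

Lemma padic_absM x y : `|x * y|_p = `|x|_p * `|y|_p.
Proof.
have [->|x0] := eqVneq x 0; first by rewrite mul0r padic_abs0 mul0r.
have [->|y0] := eqVneq y 0; first by rewrite mulr0 padic_abs0 mulr0.
rewrite /padic_abs mulf_eq0 (negbTE x0) (negbTE y0) /=.
have [pp|np] := boolP (prime p); last by rewrite !padic_val_nonprime ?mulr1.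
have p0 : p%:Q != 0 :> rat by rewrite intr_eq0 -lt0n prime_gt0.
rewrite -expfzDr//; congr (_ ^ _); rewrite -opprD; congr (- _).
rewrite -[X in padic_val p (X * _)]divq_num_den.
rewrite -[X in padic_val p (_ * X)]divq_num_den.
rewrite mulf_div -!intrM padic_val_frac ?mulf_neq0 ?numq_eq0 ?denq_neq0//.
by rewrite !abszM !lognM ?absz_gt0 ?numq_eq0 ?denq_neq0// /padic_val !PoszD
  opprD addrACA.
Qed.

Lemma padic_abs1 : `|1|_p = 1.
Proof.
by rewrite /padic_abs oner_eq0 -[1]/(1%:~R) padic_val_int logn1 oppr0 expr0z.
Qed.

Lemma padic_absN x : `|- x|_p = `|x|_p.
Proof. by rewrite /padic_abs oppr_eq0 /padic_val numqN denqN abszN. Qed.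

Lemma padic_absB x y : `|x - y|_p = `|y - x|_p.
Proof. by rewrite -opprB padic_absN. Qed.

Lemma padic_absV x : `|x^-1|_p = (`|x|_p)^-1.
Proof.
have [->|x0] := eqVneq x 0; first by rewrite !(invr0, padic_abs0).
apply: (mulfI (x := `|x|_p)); first by rewrite padic_abs_eq0.
by rewrite -padic_absM !divff ?padic_abs_eq0// padic_abs1.
Qed.

Lemma padic_abs_intE (n : int) : n != 0 ->
  `|n%:~R|_p = (p%:Q ^+ logn p `|n|)^-1.
Proof. by move=> n0; rewrite /padic_abs intr_eq0 (negbTE n0) padic_val_int exprnN. Qed.

Lemma padic_abs_intD (m n : int) :
  `|(m + n)%:~R|_p <= Num.max `|m%:~R|_p `|n%:~R|_p.
Proof.
have [->|m0] := eqVneq m 0; first by rewrite add0r le_max lexx orbT.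
have [->|n0] := eqVneq n 0; first by rewrite addr0 le_max lexx.
have [->|mn0] := eqVneq (m + n) 0; first by rewrite padic_abs0 le_max padic_abs_ge0.
rewrite !padic_abs_intE//.
have [pp|np] := boolP (prime p); last by rewrite /logn (negbTE np) le_max lexx.
have p0 : 0 < p%:Q :> rat by rewrite ltr0n prime_gt0.
have p1 : 1 <= p%:Q :> rat by rewrite ler1n prime_gt0.
have : (minn (logn p `|m|) (logn p `|n|) <= logn p (absz (m + n)%R))%N.
  rewrite -pfactor_dvdn ?absz_gt0//.
  set k := minn _ _.
  suff : (Posz (p ^ k) %| m + n)%Z by [].
  apply: rpredD.
    by rewrite /= -[_ \in _]/(p ^ k %| `|m|)%N pfactor_dvdn ?absz_gt0// geq_minl.
  by rewrite /= -[_ \in _]/(p ^ k %| `|n|)%N pfactor_dvdn ?absz_gt0// geq_minr.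
rewrite le_max geq_min => /orP[h|h]; apply/orP; [left|right];
  by rewrite lef_pV2 ?posrE ?exprn_gt0// ler_weXn2l.
Qed.

Lemma padic_absD x y : `|x + y|_p <= Num.max `|x|_p `|y|_p.
Proof.
pose dx := denq x; pose dy := denq y.
have dx0 : dx%:~R != 0 :> rat by rewrite intr_eq0 denq_neq0.
have dy0 : dy%:~R != 0 :> rat by rewrite intr_eq0 denq_neq0.
pose D : rat := dx%:~R * dy%:~R.
have D0 : D != 0 by rewrite mulf_neq0.
have Dp : 0 < `|D|_p by rewrite padic_abs_gt0.
rewrite -(ler_pM2r Dp) maxr_pMl ?padic_abs_ge0// -!padic_absM mulrDl.
have -> : x * D = (numq x * dy)%:~R.
  by rewrite -{1}(divq_num_den x) /D mulrA divfK// -intrM.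
have -> : y * D = (numq y * dx)%:~R.
  by rewrite -{1}(divq_num_den y) /D [_ * dy%:~R]mulrC mulrA divfK// -intrM.
by rewrite -intrD; exact: padic_abs_intD.
Qed.

Lemma padic_absD_lt x y e : `|x|_p < e -> `|y|_p < e -> `|x + y|_p < e.
Proof. by move=> xe ye; rewrite (le_lt_trans (padic_absD _ _))// gt_max xe. Qed.

Lemma padic_absB_lt x y e : `|x|_p < e -> `|y|_p < e -> `|x - y|_p < e.
Proof. by move=> xe ye; rewrite padic_absD_lt ?padic_absN. Qed.

Lemma padic_abs_near x y : `|x - y|_p < `|y|_p -> `|x|_p = `|y|_p.
Proof.
move=> h; have xy : `|x|_p <= `|y|_p.
  by rewrite -{1}(subrK y x) (le_trans (padic_absD _ _))// ge_max (ltW h) lexx.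
apply/eqP; rewrite eq_le xy /= leNgt; apply/negP => xy'.
have := padic_absB_lt xy' h; rewrite opprB addrCA subrr addr0 ltxx; exact: notF.
Qed.

End PadicAbs.

Definition padic_cauchy (p : nat) (u : nat -> rat) : bool :=
  `[< forall e : rat, 0 < e -> exists N, forall m n, (N <= m)%N -> (N <= n)%N ->
        padic_abs p (u m - u n) < e >].

Section CauchyRing.
Variable p : nat.
Local Notation "`| x |_p" := (padic_abs p x) (format "`| x |_p").

Lemma padic_cauchy_bounded u : padic_cauchy p u ->
  exists2 B, 0 < B & exists N, forall n, (N <= n)%N -> `|u n|_p < B.
Proof.
move=> /asboolP/(_ 1 ltr01)[N hN].
exists (`|u N|_p + 1); first by rewrite ltr_wpDl ?padic_abs_ge0.
exists N => n Nn; rewrite -(subrK (u N) (u n)) padic_absD_lt//.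
  by rewrite (lt_le_trans (hN _ _ Nn (leqnn _)))// lerDr padic_abs_ge0.
by rewrite ltrDl.
Qed.

Lemma padic_cauchy_subring : subring_closed (padic_cauchy p).
Proof.
split=> [|u v|u v].
- by apply/asboolP => e e0; exists 0%N => m n _ _; rewrite subrr padic_abs0.
- move=> /asboolP cu /asboolP cv; apply/asboolP => e e0.
  have [N hN] := cu _ e0; have [M hM] := cv _ e0.
  exists (maxn N M) => m n; rewrite !geq_max => /andP[Nm Mm] /andP[Nn Mn].
  rewrite [X in `|X|_p](_ : _ = (u m - u n) - (v m - v n)).
    by rewrite padic_absB_lt ?hN ?hM.
  by rewrite !opprD !opprK /= addrACA.
- move=> hu hv; have [B B0 [N1 h1]] := padic_cauchy_bounded hu.
  have [C C0 [N2 h2]] := padic_cauchy_bounded hv.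
  move/asboolP: hu => cu; move/asboolP: hv => cv; apply/asboolP => e e0.
  have [N hN] := cu _ (divr_gt0 e0 C0); have [M hM] := cv _ (divr_gt0 e0 B0).
  exists (maxn (maxn N1 N2) (maxn N M)) => m n.
  rewrite !geq_max => /andP[/andP[a1 a2] /andP[a3 a4]].
  move=> /andP[/andP[b1 b2] /andP[b3 b4]].
  rewrite [X in `|X|_p](_ : _ = u m * (v m - v n) + (u m - u n) * v n); last first.
    by rewrite mulrBr mulrBl addrA subrK.
  apply: padic_absD_lt; rewrite padic_absM.
    by rewrite -(mulfVK (lt0r_neq0 B0) e) mulrC ltr_pM ?padic_abs_ge0 ?hM ?h1.
  by rewrite -(mulfVK (lt0r_neq0 C0) e) ltr_pM ?padic_abs_ge0 ?hN ?h2.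
Qed.

Record padic_seq := PadicSeq {
  padic_seq_val :> nat -> rat;
  padic_seqP : padic_cauchy p padic_seq_val }.

HB.instance Definition _ := [isSub for padic_seq_val].
HB.instance Definition _ := [Choice of padic_seq by <:].
HB.instance Definition _ :=
  GRing.SubChoice_isSubComNzRing.Build (nat -> rat) (padic_cauchy p) padic_seq
    padic_cauchy_subring.

Definition padic_null (u : padic_seq) : bool :=
  `[< forall e : rat, 0 < e -> exists N, forall n, (N <= n)%N -> `|u n|_p < e >].

Lemma padic_null_ideal : idealr_closed padic_null.
Proof.
split=> [||a u v].
- by apply/asboolP => e e0; exists 0%N => n _; rewrite padic_abs0.
- apply/negP => /asboolP/(_ 1 ltr01)[N /(_ N (leqnn _))].
  by rewrite padic_abs1 ltxx.
- move=> /asboolP nu /asboolP nv; apply/asboolP => e e0.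
  have [B B0 [N1 h1]] := padic_cauchy_bounded (padic_seqP a).
  have [N hN] := nu _ (divr_gt0 e0 B0); have [M hM] := nv _ e0.
  exists (maxn N1 (maxn N M)) => n; rewrite !geq_max => /and3P[a1 a2 a3].
  apply: padic_absD_lt; last exact: hM.
  rewrite padic_absM -(mulfVK (lt0r_neq0 B0) e) mulrC.
  by rewrite ltr_pM ?padic_abs_ge0 ?hN ?h1.
Qed.

HB.instance Definition _ :=
  isIdealr.Build padic_seq padic_null padic_null_ideal.

End CauchyRing.

(* The completion of rat for padic_abs p: Cauchy sequences modulo null
   sequences. *)
Definition Qp (p : nat) := {ideal_quot (@padic_null p : idealr (padic_seq p))}.

HB.instance Definition _ (p : nat) := GRing.ComNzRing.on (Qp p).

Section QpField.
Variable p : nat.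
Local Notation "`| x |_p" := (padic_abs p x) (format "`| x |_p").

Definition Qp_pi (u : padic_seq p) : Qp p :=
  \pi_({ideal_quot (@padic_null p : idealr (padic_seq p))}) u.

Lemma Qp_piP (x : Qp p) : exists u, x = Qp_pi u.
Proof. by exists (repr x); rewrite /Qp_pi reprK. Qed.

Lemma Qp_piD : {morph Qp_pi : u v / u + v}.
Proof. by move=> u v; rewrite /Qp_pi; exact: Quotient.pi_add. Qed.

Lemma Qp_piN : {morph Qp_pi : u / - u}.
Proof. by move=> u; rewrite /Qp_pi; exact: Quotient.pi_opp. Qed.

Lemma Qp_piM : {morph Qp_pi : u v / u * v}.
Proof. by move=> u v; rewrite /Qp_pi; exact: Quotient.pi_mul. Qed.

Lemma Qp_pi1 : Qp_pi 1 = 1.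
Proof. by rewrite /Qp_pi !piE. Qed.

Lemma Qp_pi_eq u v : (Qp_pi u == Qp_pi v) = padic_null (u - v).
Proof. by rewrite /Qp_pi piE. Qed.

Lemma Qp_pi_eq0 u : (Qp_pi u == 0) = padic_null u.
Proof. by rewrite /Qp_pi piE Quotient.equivE subr0. Qed.


Lemma padic_nonnull (u : padic_seq p) : ~~ padic_null u ->
  exists2 c, 0 < c & exists N, forall n, (N <= n)%N -> `|u n|_p = c.
Proof.
move=> /asboolPn/existsNP[e]/not_implyP[e0 /forallNP ne].
have /asboolP/(_ _ e0)[N hN] := padic_seqP u.
have /existsNP[k /not_implyP[Nk /negP]] := ne N; rewrite -leNgt => ek.
exists `|u k|_p; first exact: lt_le_trans ek.
exists N => n Nn; apply: padic_abs_near.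
exact: lt_le_trans (hN _ _ Nn Nk) ek.
Qed.

Lemma padic_seq_inv (u : padic_seq p) : ~~ padic_null u ->
  exists v : padic_seq p, padic_null (v * u - 1).
Proof.
move=> /padic_nonnull[c c0 [N hN]].
have cv : padic_cauchy p (fun n => (u n)^-1).
  apply/asboolP => e e0.
  have /asboolP/(_ (e * c * c))[|M hM] := padic_seqP u.
    by rewrite !mulr_gt0.
  exists (maxn N M) => m n; rewrite !geq_max => /andP[Nm Mm] /andP[Nn Mn].
  have nz k : (N <= k)%N -> u k != 0.
    by move=> /hN uk; rewrite -(padic_abs_eq0 p) uk gt_eqF.
  rewrite [X in `|X|_p](_ : _ = (u n - u m) / (u n * u m)).
    rewrite padic_absM padic_absV padic_absM !hN//.
    by rewrite ltr_pdivrMr ?mulr_gt0// mulrA hM.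
  by rewrite mulrBl invfM mulrA divff ?nz// mul1r mulrCA divff ?nz// mulr1.
exists (PadicSeq cv); apply/asboolP => e e0; exists N => n Nn.
have un : u n != 0 by rewrite -(padic_abs_eq0 p) hN// gt_eqF.
by rewrite /= -[X in `|X|_p]/((u n)^-1 * u n - 1) mulVf// subrr padic_abs0.
Qed.

Lemma Qp_inv_ex (x : Qp p) : exists y : Qp p,
  (x != 0 -> y * x = 1) /\ (x = 0 -> y = 0).
Proof.
have [->|x0] := eqVneq x 0; first by exists 0.
have [u xu] := Qp_piP x; move: x0; rewrite xu Qp_pi_eq0 => /padic_seq_inv[v uv].
exists (Qp_pi v); split.
  by move=> _; apply/eqP; rewrite -Qp_piM -Qp_pi1 Qp_pi_eq.
move=> /eqP; rewrite Qp_pi_eq0 => nu; exfalso.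
move: uv; rewrite -Qp_pi_eq Qp_piM.
move: nu; rewrite -Qp_pi_eq0 => /eqP ->; rewrite mulr0 Qp_pi1 eq_sym.
by rewrite oner_eq0.
Qed.

Definition Qp_inv (x : Qp p) : Qp p := projT1 (cid (Qp_inv_ex x)).

Lemma Qp_mulVf (x : Qp p) : x != 0 -> Qp_inv x * x = 1.
Proof. exact: (projT2 (cid (Qp_inv_ex x))).1. Qed.

Lemma Qp_invr0 : Qp_inv 0 = 0.
Proof. exact: (projT2 (cid (Qp_inv_ex 0))).2. Qed.

HB.instance Definition _ := GRing.ComNzRing_isField.Build (Qp p)
  Qp_mulVf Qp_invr0.

Definition padic_abs_lim (u : nat -> rat) (c : rat) : Prop :=
  forall e : rat, 0 < e ->
    exists N, forall n, (N <= n)%N -> `| `|u n|_p - c | < e.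

(* Absolute values of p-adic numbers are powers of p or 0, hence rational.
   Qp is a metric space but not a normedZmodType, whose norm would have to
   satisfy `|x *+ n| = `|x| *+ n. *)
Definition Qp_abs (x : Qp p) : rat :=
  xget 0 [set c | padic_abs_lim (repr x) c].

Lemma padic_abs_lim_unique u c d :
  padic_abs_lim u c -> padic_abs_lim u d -> c = d.
Proof.
move=> uc ud; apply/eqP; rewrite -subr_eq0 -normr_eq0; apply/negPn/negP => cd.
have e0 : 0 < `|c - d| / 2 by rewrite divr_gt0// lt0r cd normr_ge0.
have [N hN] := uc _ e0; have [M hM] := ud _ e0.
have := ltrD (hN _ (leq_maxl N M)) (hM _ (leq_maxr N M)).
rewrite -splitr distrC => /(le_lt_trans (ler_normD _ _)).
by rewrite addrA subrK ltxx.
Qed.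

Lemma padic_abs_lim_ex (u : padic_seq p) : exists c, padic_abs_lim u c.
Proof.
have [nu|/padic_nonnull[c c0 [N hN]]] := boolP (padic_null u).
  exists 0 => e e0; have /asboolP/(_ _ e0)[N hN] := nu.
  by exists N => n Nn; rewrite subr0 ger0_norm ?padic_abs_ge0// hN.
by exists c => e e0; exists N => n /hN ->; rewrite subrr normr0.
Qed.

Lemma Qp_abs_piE (u : padic_seq p) c : padic_abs_lim u c -> Qp_abs (Qp_pi u) = c.
Proof.
move=> uc; rewrite /Qp_abs; case: xgetP => [d _ ud|/(_ _)/= nd]; last first.
  by have [d ud] := padic_abs_lim_ex (repr (Qp_pi u)); case: (nd d).
move: ud => /= ud.
suff ud' : padic_abs_lim u d by exact: padic_abs_lim_unique ud' uc.
have /asboolP nuv : padic_null (repr (Qp_pi u) - u).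
  by rewrite -Qp_pi_eq /Qp_pi reprK.
move: (repr (Qp_pi u)) nuv ud => v nvu vd.
have [nv|/[dup] nnv /padic_nonnull[c' c'0 [N hN]]] := boolP (padic_null v).
  have d0 : d = 0.
    apply: padic_abs_lim_unique vd _ => e e0.
    move/asboolP: nv => /(_ _ e0)[N hN].
    by exists N => n Nn; rewrite subr0 ger0_norm ?padic_abs_ge0// hN.
  rewrite d0 => e e0; move/asboolP: nv => /(_ _ e0)[N hN].
  have [M hM] := nvu _ e0; exists (maxn N M) => n.
  rewrite geq_max => /andP[Nn Mn]; rewrite subr0 ger0_norm ?padic_abs_ge0//.
  rewrite (_ : u n = v n - (v - u) n); first by rewrite padic_absB_lt ?hN ?hM.
  by rewrite -[(v - u) n]/(v n - u n) opprB addrC subrK.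
move=> e e0; have [M hM] := nvu _ c'0; have [K hK] := vd _ e0.
exists (maxn N (maxn M K)) => n; rewrite !geq_max => /and3P[Nn Mn Kn].
rewrite (@padic_abs_near p (u n) (v n)); first exact: hK.
by rewrite hN// padic_absB; exact: (hM n Mn).
Qed.

Lemma Qp_abs_lim (u : padic_seq p) : padic_abs_lim u (Qp_abs (Qp_pi u)).
Proof. by have [c uc] := padic_abs_lim_ex u; rewrite (Qp_abs_piE uc). Qed.

Lemma Qp_abs_ev (u : padic_seq p) : Qp_pi u != 0 ->
  exists N, forall n, (N <= n)%N -> `|u n|_p = Qp_abs (Qp_pi u).
Proof.
rewrite Qp_pi_eq0 => /padic_nonnull[c _ [N hN]]; exists N => n Nn.
rewrite (@Qp_abs_piE u c) ?hN// => e e0.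
by exists N => k /hN ->; rewrite subrr normr0.
Qed.

Lemma Qp_pi0 : Qp_pi 0 = 0.
Proof.
apply/eqP; rewrite Qp_pi_eq0; apply/asboolP => e e0.
by exists 0%N => n _; rewrite padic_abs0.
Qed.

Lemma Qp_abs_ge0 x : 0 <= Qp_abs x.
Proof.
have [u ->] := Qp_piP x; rewrite leNgt; apply/negP => c0.
have [|N hN] := @Qp_abs_lim u (- Qp_abs (Qp_pi u)); first by rewrite oppr_gt0.
have := hN N (leqnn _); rewrite ger0_norm; last first.
  by rewrite subr_ge0 (le_trans (ltW c0))// padic_abs_ge0.
by rewrite gtrDr ltNge padic_abs_ge0.
Qed.

Lemma Qp_abs0 : Qp_abs 0 = 0.
Proof.
rewrite -Qp_pi0; apply: Qp_abs_piE => e e0.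
by exists 0%N => n _; rewrite padic_abs0 subrr normr0.
Qed.

Lemma Qp_abs_eq0 x : (Qp_abs x == 0) = (x == 0).
Proof.
apply/idP/idP => [/eqP x0|/eqP ->]; last by rewrite Qp_abs0.
move: x0; have [u ->] := Qp_piP x => u0; rewrite Qp_pi_eq0.
apply/asboolP => e /(Qp_abs_lim u)[N hN]; exists N => n /hN.
by rewrite u0 subr0 ger0_norm ?padic_abs_ge0.
Qed.

Lemma Qp_absM : {morph Qp_abs : x y / x * y}.
Proof.
move=> x y; have [->|] := eqVneq x 0; first by rewrite mul0r Qp_abs0 mul0r.
have [->|] := eqVneq y 0; first by rewrite mulr0 Qp_abs0 mulr0.
have [[u ->] [v ->]] := (Qp_piP x, Qp_piP y).
move=> /Qp_abs_ev[N hN] /Qp_abs_ev[M hM]; rewrite -Qp_piM.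
apply: Qp_abs_piE => e e0; exists (maxn N M) => n.
rewrite geq_max => /andP[Nn Mn].
by rewrite -[(u * v) n]/(u n * v n) padic_absM hN// hM// subrr normr0.
Qed.

Lemma Qp_absN : {morph Qp_abs : x / - x >-> x}.
Proof.
move=> x; have [u ->] := Qp_piP x; rewrite -Qp_piN.
apply: Qp_abs_piE => e /(Qp_abs_lim u)[N hN]; exists N => n /hN.
by rewrite -[(- u) n]/(- u n) padic_absN.
Qed.

Lemma Qp_absD x y : Qp_abs (x + y) <= Num.max (Qp_abs x) (Qp_abs y).
Proof.
have [->|] := eqVneq x 0; first by rewrite add0r le_max lexx orbT.
have [->|] := eqVneq y 0; first by rewrite addr0 le_max lexx.
have [->|] := eqVneq (x + y) 0; first by rewrite Qp_abs0 le_max Qp_abs_ge0.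
have [[u ->] [v ->]] := (Qp_piP x, Qp_piP y); rewrite -Qp_piD.
move=> /Qp_abs_ev[K hK] /Qp_abs_ev[N hN] /Qp_abs_ev[M hM].
pose n := maxn K (maxn N M).
rewrite -(hK n) -?(hN n) -?(hM n) ?leq_max ?leqnn ?orbT//.
exact: padic_absD.
Qed.

Lemma Qp_absD_lt x y e : Qp_abs x < e -> Qp_abs y < e -> Qp_abs (x + y) < e.
Proof. by move=> xe ye; rewrite (le_lt_trans (Qp_absD _ _))// gt_max xe. Qed.

Lemma padic_cst_cauchy (c : rat) : padic_cauchy p (fun=> c).
Proof.
by apply/asboolP => e e0; exists 0%N => m n _ _; rewrite subrr padic_abs0.
Qed.

Lemma Qp_pi_nat k : Qp_pi (PadicSeq (padic_cst_cauchy k%:R)) = k%:R.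
Proof.
elim: k => [|k IH].
  by rewrite -[RHS]Qp_pi0; congr Qp_pi; apply: val_inj.
rewrite -[RHS]natr1 -IH -Qp_pi1 -Qp_piD; congr Qp_pi; apply: val_inj.
by apply/funext => n /=; rewrite -natr1.
Qed.

Lemma Qp_pi_int k : Qp_pi (PadicSeq (padic_cst_cauchy k%:~R)) = k%:~R.
Proof.
case: k => k; first exact: Qp_pi_nat.
rewrite NegzE [RHS]mulrNz -pmulrn -[in RHS]Qp_pi_nat -Qp_piN; congr Qp_pi.
by apply: val_inj; apply/funext => n /=; rewrite mulrNz.
Qed.

Lemma Qp_ratrE c : ratr c = Qp_pi (PadicSeq (padic_cst_cauchy c)).
Proof.
have d0 : (denq c)%:~R != 0 :> Qp p.
  rewrite -Qp_pi_int Qp_pi_eq0; apply/negP => /asboolP.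
  move=> /(_ `|(denq c)%:~R|_p)[|N /(_ _ (leqnn N))].
    by rewrite padic_abs_gt0// intr_eq0 denq_neq0.
  by rewrite ltxx.
apply: (mulIf d0); rewrite divfK// -!Qp_pi_int -Qp_piM; congr Qp_pi.
apply: val_inj; apply/funext => n /=.
rewrite -[RHS]/(c * (denq c)%:~R) -{2}(divq_num_den c) divfK//.
by rewrite intr_eq0 denq_neq0.
Qed.

Lemma Qp_abs_ratr c : Qp_abs (ratr c) = `|c|_p.
Proof.
rewrite Qp_ratrE; apply: Qp_abs_piE => e e0.
by exists 0%N => n _; rewrite subrr normr0.
Qed.

Lemma Qp_ratrB c d : ratr (c - d) = ratr c - ratr d :> Qp p.
Proof.
by rewrite !Qp_ratrE -Qp_piN -Qp_piD; congr Qp_pi; exact: val_inj.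
Qed.

Definition Qp_dist (x y : Qp p) : rat := Qp_abs (x - y).

Lemma Qp_distxx x : Qp_dist x x = 0.
Proof. by rewrite /Qp_dist subrr Qp_abs0. Qed.

Lemma Qp_dist_eq x y : Qp_dist x y = 0 -> x = y.
Proof. by move/eqP; rewrite Qp_abs_eq0 subr_eq0 => /eqP. Qed.

Lemma Qp_dist_sym x y : Qp_dist x y = Qp_dist y x.
Proof. by rewrite /Qp_dist -opprB Qp_absN. Qed.

Lemma Qp_dist_ultra y x z e : Qp_dist x y < e -> Qp_dist y z < e ->
  Qp_dist x z < e.
Proof.
by move=> xy yz; rewrite /Qp_dist -(subrK y x) -addrA Qp_absD_lt.
Qed.

Lemma Qp_dist_triangle y x z : Qp_dist x z <= Qp_dist x y + Qp_dist y z.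
Proof.
rewrite /Qp_dist -{1}(subrK y x) -addrA (le_trans (Qp_absD _ _))// ge_max.
by rewrite lerDl lerDr !Qp_abs_ge0.
Qed.

HB.instance Definition _ := isPointed.Build (Qp p) 0.
HB.instance Definition _ := isMetric.Build rat (Qp p)
  Qp_distxx Qp_dist_eq Qp_dist_sym Qp_dist_triangle.

Lemma Qp_ballE (x : Qp p) (e : rat) : ball x e = [set y | Qp_abs (x - y) < e].
Proof. by rewrite ballEmdist. Qed.

Lemma Qp_dense (x : Qp p) (e : rat) : 0 < e -> exists c, Qp_abs (x - ratr c) < e.
Proof.
move=> e0; have [u ->] := Qp_piP x.
have e20 : 0 < e / 2 by rewrite divr_gt0.
have /asboolP/(_ _ e20)[N hN] := padic_seqP u.
exists (u N); rewrite Qp_ratrE -Qp_piN -Qp_piD.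
set w := u - _; have [M hM] := Qp_abs_lim w e20.
pose n := maxn N M; have := hN _ _ (leq_maxl N M : (N <= n)%N) (leqnn N).
have := hM _ (leq_maxr N M : (M <= n)%N).
rewrite distrC -[w n]/(u n - u N) => wn un.
rewrite -(subrK (`|u n - u N|_p) (Qp_abs _)) [e]splitr ltrD//.
exact: le_lt_trans (ler_norm _) wn.
Qed.

Lemma Qp_complete (F : set_system (Qp p)) :
  ProperFilter F -> cauchy F -> cvg F.
Proof.
move=> FF /cauchyP Fc.
have ex (k : nat) : exists c : rat, F (ball (ratr c : Qp p) k.+1%:R^-1).
  have k0 : 0 < k.+1%:R^-1 :> rat by rewrite invr_gt0 ltr0n.
  have [x Fx] := Fc _ k0; have [c xc] := Qp_dense x k0.
  exists c; apply: filterS Fx => y; rewrite !Qp_ballE /= => xy.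
  by apply: (@Qp_dist_ultra x); rewrite // Qp_dist_sym.
pose c k := projT1 (cid (ex k)).
have hc k : F (ball (ratr (c k) : Qp p) k.+1%:R^-1) := projT2 (cid (ex k)).
have close j k : Qp_abs (ratr (c j) - ratr (c k)) < (minn j k).+1%:R^-1.
  have [y []] := filter_ex (filterI (hc j) (hc k)).
  rewrite !Qp_ballE /= => jy ky.
  apply: (@Qp_dist_ultra y).
    by rewrite (lt_le_trans jy)// lef_pV2 ?posrE ?ltr0n// ler_nat ltnS geq_minl.
  rewrite Qp_dist_sym (lt_le_trans ky)//.
  by rewrite lef_pV2 ?posrE ?ltr0n// ler_nat ltnS geq_minr.
have arch (e : rat) : 0 < e -> exists N, N.+1%:R^-1 < e.
  move=> e0; exists (Num.bound e^-1).
  rewrite invf_plt ?posrE ?ltr0n// (lt_trans (archi_boundP _)) ?invr_ge0 ?ltW//.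
  by rewrite ltr_nat.
have cc : padic_cauchy p c.
  apply/asboolP => e /arch[N Ne]; exists N => m n Nm Nn.
  rewrite -Qp_abs_ratr Qp_ratrB (lt_trans _ Ne)//.
  rewrite (lt_le_trans (close m n))// lef_pV2 ?posrE ?ltr0n//.
  by rewrite ler_nat ltnS leq_min Nm.
pose x := Qp_pi (PadicSeq cc).
have xc (e : rat) : 0 < e -> exists N, forall k, (N <= k)%N ->
    Qp_abs (x - ratr (c k)) < e.
  move=> e0; have e20 : 0 < e / 2 by rewrite divr_gt0.
  have /asboolP/(_ _ e20)[N hN] := cc; exists N => k Nk.
  rewrite /x Qp_ratrE -Qp_piN -Qp_piD.
  set w := PadicSeq cc - _; have [M hM] := Qp_abs_lim w e20.
  pose n := maxn N M; have := hN _ _ (leq_maxl N M : (N <= n)%N) Nk.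
  have := hM _ (leq_maxr N M : (M <= n)%N).
  rewrite distrC -[w n]/(c n - c k) => wn un.
  rewrite -(subrK (`|c n - c k|_p) (Qp_abs _)) [e]splitr ltrD//.
  exact: le_lt_trans (ler_norm _) wn.
apply/cvg_ex; exists x => A; rewrite -nbhs_ballE => -[e /= e0].
rewrite Qp_ballE => xA.
have [N hN] := xc _ e0; have [M Me] := arch _ e0.
have := hc (maxn N M); apply: filterS => y; rewrite Qp_ballE /= => cy.
apply: xA => /=; apply: (@Qp_dist_ultra (ratr (c (maxn N M)))).
  by rewrite /Qp_dist hN// leq_maxl.
rewrite (lt_trans _ Me)// (lt_le_trans cy)//.
by rewrite lef_pV2 ?posrE ?ltr0n// ler_nat ltnS leq_maxr.
Qed.

HB.instance Definition _ := Uniform_isComplete.Build (Qp p) Qp_complete.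

End QpField.

(* The convergence for p prime and Qp_abs z <= 1 is euler_series_cvg. *)
Definition euler_series (p : nat) (z : Qp p) : Qp p :=
  lim (series (fun n => (n`!)%:R * z ^+ n) @ \oo).

Lemma euler_series_cvg (p : nat) (z : Qp p) : prime p -> Qp_abs z <= 1 ->
  cvg (series (fun n => (n`!)%:R * z ^+ n) @ \oo).
Proof.
move=> pp z1; apply: cauchy_cvg; apply: (@cauchy_exP rat) => e e0.
have p_gt0 : (0 < p)%N := prime_gt0 pp.
have zn n : Qp_abs (z ^+ n) <= 1.
  elim: n => [|n IH]; last by rewrite exprS Qp_absM mulr_ile1 ?Qp_abs_ge0.
  by rewrite expr0 -[1]/(1%:R) -ratr_nat Qp_abs_ratr padic_abs1.
have [N Ne] : exists N, (p%:Q ^+ N)^-1 < e.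
  exists (Num.bound e^-1); rewrite invf_plt ?posrE ?exprn_gt0 ?ltr0n//.
  rewrite (lt_trans (archi_boundP _)) ?invr_ge0 ?ltW//.
  by rewrite -pmulrn -natrX ltr_nat ltn_expl// prime_gt1.
have term k : (p ^ N <= k)%N -> Qp_abs ((k`!)%:R * z ^+ k) < e.
  move=> Nk; rewrite Qp_absM (le_lt_trans _ Ne)//.
  rewrite (le_trans (ler_piMr (Qp_abs_ge0 _) (zn k)))//.
  rewrite -ratr_nat Qp_abs_ratr pmulrn padic_abs_intE; last first.
    by rewrite -lt0n fact_gt0.
  rewrite lef_pV2 ?posrE ?exprn_gt0 ?ltr0n// ler_weXn2l ?ler1n//.
  by rewrite /= -pfactor_dvdn ?fact_gt0// dvdn_fact// expn_gt0 p_gt0.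
exists (series (fun n => (n`!)%:R * z ^+ n) (p ^ N)%N).
exists (p ^ N)%N => // n /= Nn; rewrite Qp_ballE /=.
rewrite -opprB Qp_absN sub_series_geq// big_nat.
by elim/big_ind : _ => [|x y|k /andP[/term//]];
  [rewrite Qp_abs0|exact: Qp_absD_lt].
Qed.

Definition Lambda (K : pzRingType) (a b : int) (x : K) : K :=
  a%:~R - b%:~R * x.

Definition residue_class (m : nat) (h : int) : set int :=
  [set h + k * m%:Z | k in [set: int]].

Definition reduced_residue_system (m : nat) : set (set int) :=
  [set residue_class m h | h in [set h : int | coprimez h m%:Z]].

(* Main.v *)
Require Import Defs.
From HB Require Import structures.
From mathcomp Require Import all_boot all_order all_algebra.
From mathcomp Require Import mathcomp_extra boolp classical_sets functions.
From mathcomp Require Import cardinality topology sequences.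
From mathcomp Require Import reals normedtype exp.
From mathcomp Require Import ring lra zify.
Set Implicit Arguments.
Unset Strict Implicit.
Unset Printing Implicit Defensive.
Import Order.TTheory GRing.Theory Num.Theory.
Import numFieldNormedType.Exports.
Local Open Scope classical_set_scope.
Local Open Scope ring_scope.

(** The series [F = \sum_n n! xi^n] has Pade approximants [A_n / B_n] (the [B_n]
    are Laguerre polynomials in disguise) with [|A_n|, |B_n| <= C^n n!] while
    [B_n F_p(xi) - A_n] is p-adically divisible by [n!^2] for every prime p. If
    [b F_p(xi) = a] for all large primes of [R], the integer
    [D_n = a B_n - b A_n] is divisible by the [R]-part of [n!^2], whose logarithm
    is [2 n \sum_(p <= n, p in R) ln p / p + O(n)], that is,
    [(2 r / phi(m)) n ln n + O(n)] by Mertens' theorem in arithmetic progressions.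
    As two consecutive [D_n] do not both vanish and [ln |D_n| <= n ln n + O(n)],
    this contradicts [2 r > phi(m)].

    Mertens' theorem in progressions is obtained over the reals, without complex
    characters. On the space of m-periodic functions of mean zero supported on the
    reduced residues, [T f = (h |-> \sum_n f(h n) / n)] commutes with dilations,
    and [\sum_(n <= N) Lambda(n)/n (T f)(n)] is bounded. It remains to see that
    [T] is injective, hence onto. If [T f = 0], Moebius inversion gives
    [\sum_(n <= N) Lambda(n)/n f(n) = - f(1) ln N + O(1)]; applied to the
    autocorrelation of [f], whose maximum is at 1, this forces almost all primes h
    to satisfy [f(g h) = - f(g)] for all g. Those h generate all classes, so [f]
    is a multiple of a real character chi with [L(1, chi) = 0], which Monsky's
    argument with the Lambert series [\sum_n chi(n) t^n / (1 - t^n)] excludes. *)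

(** * Divisor sums *)

(** Splitting off the full power of one prime at a time keeps the cofactor prime to it, which suits
    sums over divisors. *)
Lemma pfactor_ind (P : nat -> Prop) : P 1%N ->
  (forall p a n, prime p -> ~~ (p %| n)%N -> (0 < n)%N -> P n ->
    P (p ^ a.+1 * n)%N) ->
  forall n, (0 < n)%N -> P n.
Proof.
move=> P1 Pp; elim/ltn_ind => n IH n_gt0.
have [->//|n1] := eqVneq n 1%N.
have n_gt1 : (1 < n)%N by rewrite ltn_neqAle eq_sym n1.
have pp := pdiv_prime n_gt1; set p := pdiv n in pp.
have [k copk defn] := pfactor_coprime pp n_gt0.
have v_gt0 : (0 < logn p n)%N by rewrite logn_gt0 mem_primes pp n_gt0 pdiv_dvd.
have k_gt0 : (0 < k)%N by move: n_gt0; rewrite defn muln_gt0 => /andP[].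
rewrite defn mulnC -(prednK v_gt0); apply: Pp => //.
  by rewrite -prime_coprime.
apply: IH => //; rewrite [X in (_ < X)%N]defn -{1}[k]muln1 ltn_pmul2l//.
by rewrite -(exp1n (logn p n)) ltn_exp2r ?prime_gt1.
Qed.

Lemma perm_divisors_pfactor p a n : prime p -> ~~ (p %| n)%N -> (0 < n)%N ->
  perm_eq (divisors (p ^ a.+1 * n))
    (divisors n ++ [seq (p * d)%N | d <- divisors (p ^ a * n)]).
Proof.
move=> pp pn n_gt0; have p_gt0 := prime_gt0 pp.
apply: uniq_perm; first exact: divisors_uniq.
  rewrite cat_uniq divisors_uniq map_inj_uniq ?divisors_uniq ?andbT /=; last first.
    by move=> x y /eqP; rewrite eqn_pmul2l// => /eqP.
  apply/hasPn => _ /mapP[e _ ->]; apply/negP; rewrite /= -dvdn_divisors// => pe.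
  by move/negP: pn; apply; apply: dvdn_trans pe; exact: dvdn_mulr.
move=> d; rewrite mem_cat -!dvdn_divisors ?muln_gt0 ?expn_gt0 ?p_gt0//.
have [/dvdnP[e ->]|pd] := boolP (p %| d)%N.
  rewrite mulnC mem_map; last by move=> x y /eqP; rewrite eqn_pmul2l// => /eqP.
  rewrite -dvdn_divisors ?muln_gt0 ?expn_gt0 ?p_gt0//.
  rewrite expnS -mulnA dvdn_pmul2l//; case: (boolP (p * e %| n)%N) => //= pe.
  by move/negP: pn; case; apply: dvdn_trans pe; exact: dvdn_mulr.
rewrite Gauss_dvdr; last by rewrite coprime_sym coprimeXl// prime_coprime.
case: (boolP (d %| n)%N) => //= _; apply/esym/negP => /mapP[e _ de].
by move/negP: pd; apply; rewrite de dvdn_mulr.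
Qed.

Section DivisorSums.
Variable V : nmodType.

Lemma sum_divisors_pfactor (F : nat -> V) p a n :
  prime p -> ~~ (p %| n)%N -> (0 < n)%N ->
  \sum_(d <- divisors (p ^ a.+1 * n)) F d =
  \sum_(d <- divisors n) F d + \sum_(d <- divisors (p ^ a * n)) F (p * d)%N.
Proof.
by move=> pp pn n0; rewrite (perm_big _ (perm_divisors_pfactor a pp pn n0))
  big_cat big_map.
Qed.

(** Writing [n = d * k] turns a sum of Dirichlet convolutions into a double sum; the convolution
    identities below pass through this exchange. *)
Lemma sum_divisors_hyperbola (F : nat -> nat -> V) N :
  \sum_(1 <= n < N.+1) \sum_(d <- divisors n) F d (n %/ d)%N =
  \sum_(1 <= d < N.+1) \sum_(1 <= k < (N %/ d).+1) F d k.
Proof.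
transitivity (\sum_(1 <= n < N.+1) \sum_(1 <= d < N.+1 | (d %| n)%N)
    F d (n %/ d)%N).
  apply: eq_big_nat => n /andP[n0 nN].
  rewrite -[RHS]big_filter; apply: perm_big; apply: uniq_perm.
  - exact: divisors_uniq.
  - by rewrite filter_uniq// iota_uniq.
  move=> d; rewrite -dvdn_divisors// mem_filter mem_index_iota.
  have [dn|//] := boolP (d %| n)%N; rewrite /= (dvdn_gt0 n0 dn) /=.
  by rewrite (leq_ltn_trans _ nN)// dvdn_leq.
rewrite (exchange_big_dep_nat xpredT)//=.
apply: eq_big_nat => d /andP[d0 dN].
rewrite -[LHS]big_filter.
rewrite (perm_big [seq (d * k)%N | k <- index_iota 1 (N %/ d).+1]).
  by rewrite big_map; apply: eq_bigr => k _; rewrite mulKn.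
apply: uniq_perm; first by rewrite filter_uniq// iota_uniq.
  rewrite map_inj_uniq ?iota_uniq// => x y /eqP.
  by rewrite eqn_pmul2l// => /eqP.
move=> n; rewrite mem_filter mem_index_iota; apply/idP/mapP.
  move=> /and3P[/dvdnP[k ->] k0]; rewrite ltnS => kN; exists k; last by rewrite mulnC.
  rewrite mem_index_iota ltnS leq_divRL// kN andbT.
  by move: k0; rewrite muln_gt0 => /andP[].
move=> [k]; rewrite mem_index_iota ltnS leq_divRL// => /andP[k0 kN] ->.
by rewrite dvdn_mulr// muln_gt0 d0 k0 ltnS mulnC.
Qed.

End DivisorSums.

(** * The Moebius and von Mangoldt functions *)

Lemma perm_primes_pfactor p a n : prime p -> ~~ (p %| n)%N -> (0 < n)%N ->
  perm_eq (primes (p ^ a.+1 * n)) (p :: primes n).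
Proof.
move=> pp pn n0; apply: uniq_perm; rewrite /= ?primes_uniq ?andbT//.
  by rewrite mem_primes (negbTE pn) !andbF.
by move=> q; rewrite primesM ?n0 ?expn_gt0 ?prime_gt0// primesX// primes_prime// !inE.
Qed.

Section ArithmeticFunctions.
Variable R : realType.

(* [primes 0 = [::]], so that [mobius 0 = 1]; sums over [n] start at 1. *)
Definition mobius (n : nat) : R :=
  \prod_(p <- primes n) (if logn p n == 1%N then -1 else 0).

Definition mangoldt (n : nat) : R :=
  if primes n is [:: p] then ln p%:R else 0.

Lemma mobius1 : mobius 1 = 1.
Proof. by rewrite /mobius big_nil. Qed.

Lemma norm_mobius n : `|mobius n| <= 1.
Proof.
rewrite /mobius; apply: (big_ind (fun x => `|x| <= 1)) => [|x y x1 y1|p _].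
- by rewrite normr1.
- by rewrite normrM mulr_ile1.
- by case: ifP => _; rewrite ?normrN ?normr1 ?normr0.
Qed.

Lemma mobius_pM p n : prime p -> ~~ (p %| n)%N -> (0 < n)%N ->
  mobius (p * n) = - mobius n.
Proof.
move=> pp pn n0; have := perm_primes_pfactor 0 pp pn n0; rewrite expn1 => pe.
have p0 := prime_gt0 pp.
rewrite /mobius (perm_big _ pe) big_cons lognM ?p0// /= (logn_prime p pp).
rewrite eqxx (_ : logn p n = 0%N); last first.
  by apply/eqP; rewrite lognE pp n0 (negbTE pn).
rewrite addn0 eqxx mulN1r; congr (- _); apply: eq_big_seq => q.
rewrite mem_primes => /and3P[qp _ qn]; rewrite lognM ?p0// (logn_prime q pp).
by have [e|] := eqVneq q p; first by move: qn; rewrite e (negbTE pn).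
Qed.

Lemma mobius_ppM p n : prime p -> (0 < n)%N -> mobius (p * (p * n)) = 0.
Proof.
move=> pp n0; have p0 := prime_gt0 pp.
rewrite /mobius (big_rem p) /=; last first.
  by rewrite mem_primes pp !muln_gt0 p0 n0 dvdn_mulr.
by rewrite !lognM ?muln_gt0 ?p0// (logn_prime p pp) eqxx mul0r.
Qed.

Lemma sum_divisors_mobius_pM (G : nat -> R) p a n :
  prime p -> ~~ (p %| n)%N -> (0 < n)%N ->
  \sum_(d <- divisors (p ^ a * n)) mobius (p * d) * G d =
  - \sum_(d <- divisors n) mobius d * G d.
Proof.
move=> pp pn n0.
have base : \sum_(d <- divisors n) mobius (p * d) * G d =
    - \sum_(d <- divisors n) mobius d * G d.
  rewrite -sumrN; apply: eq_big_seq => d; rewrite -dvdn_divisors// => dn.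
  rewrite mobius_pM ?mulNr ?(dvdn_gt0 n0)//.
  by apply: contra pn => /dvdn_trans; exact.
case: a => [|a]; first by rewrite expn0 mul1n.
rewrite sum_divisors_pfactor// base [X in _ + X]big_seq [X in _ + X]big1 ?addr0// => d.
rewrite -dvdn_divisors ?muln_gt0 ?n0 ?expn_gt0 ?prime_gt0// => dn.
rewrite mobius_ppM ?mul0r//; apply: dvdn_gt0 dn.
by rewrite muln_gt0 n0 expn_gt0 prime_gt0.
Qed.

Lemma sum_mobius n : (0 < n)%N ->
  \sum_(d <- divisors n) mobius d = (n == 1%N)%:R.
Proof.
move: n; apply: pfactor_ind => [|p a n pp pn n0 _].
  by rewrite (_ : divisors 1 = [:: 1%N])// big_seq1 mobius1.
rewrite sum_divisors_pfactor//.
have := sum_divisors_mobius_pM (fun=> 1) a pp pn n0.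
under eq_bigr do rewrite mulr1.
under [in RHS]eq_bigr do rewrite mulr1.
move=> ->; rewrite subrr; case: eqVneq => // /eqP.
by rewrite muln_eq1 expnS muln_eq1; case: (p =P 1%N) pp => [->|].
Qed.

Lemma mangoldt_pfactor p a n : prime p -> ~~ (p %| n)%N -> (0 < n)%N ->
  mangoldt (p ^ a.+1 * n) = ln p%:R *+ (n == 1%N).
Proof.
move=> pp pn n0; rewrite /mangoldt.
have [->|n1] := eqVneq n 1%N; first by rewrite muln1 primesX// primes_prime.
move: (perm_primes_pfactor a pp pn n0) => /perm_size; have : size (primes n) != 0%N.
  rewrite size_eq0; apply/eqP => e.
  have : pdiv n \in primes n.
    by rewrite mem_primes pdiv_prime ?n0 ?pdiv_dvd// ltn_neqAle eq_sym n1.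
  by rewrite e.
case: (primes n) => [//|x s] _.
by case: (primes _) => [|y []].
Qed.

Lemma mangoldt_prime p : prime p -> mangoldt p = ln p%:R.
Proof. by move=> pp; rewrite /mangoldt primes_prime. Qed.

Lemma mangoldt_ge0 n : 0 <= mangoldt n.
Proof.
rewrite /mangoldt; case E: (primes n) => [|p []]//; rewrite ln_ge0// ler1n.
have : p \in primes n by rewrite E inE.
by rewrite mem_primes => /andP[/prime_gt0].
Qed.

Lemma sum_mangoldt n : (0 < n)%N ->
  \sum_(d <- divisors n) mangoldt d = ln n%:R.
Proof.
move: n; apply: pfactor_ind => [|p a n pp pn n0 IH].
  by rewrite (_ : divisors 1 = [:: 1%N])// big_seq1 /mangoldt ln1.
have p0 := prime_gt0 pp.
have base : \sum_(d <- divisors n) mangoldt (p * d) = ln p%:R.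
  have d1 : 1%N \in divisors n by rewrite -dvdn_divisors.
  rewrite (bigD1_seq 1%N) ?divisors_uniq//= big_seq_cond big1 ?addr0.
    by rewrite muln1 mangoldt_prime.
  move=> d /andP[]; rewrite -dvdn_divisors// => dn dn1.
  have := @mangoldt_pfactor p 0 d pp; rewrite expn1 => ->.
  - by rewrite (negbTE dn1).
  - by apply: contra pn => /dvdn_trans; exact.
  - exact: dvdn_gt0 dn.
rewrite sum_divisors_pfactor// IH natrM lnM ?posrE ?ltr0n ?expn_gt0 ?p0//.
rewrite natrX lnXn ?ltr0n// addrC; congr (_ + _).
elim: a => [|a IHa]; first by rewrite expn0 mul1n.
rewrite sum_divisors_pfactor// base mulrS -IHa; congr (_ + _).
apply: eq_big_seq => d; rewrite -dvdn_divisors ?muln_gt0 ?expn_gt0 ?p0// => dn.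
have d0 : (0 < d)%N by rewrite (dvdn_gt0 _ dn)// muln_gt0 expn_gt0 p0.
rewrite /mangoldt (_ : primes (p * (p * d)) = primes (p * d))//.
apply: (@irr_sorted_eq _ ltn); [exact: ltn_trans|exact: ltnn|..];
  rewrite ?sorted_primes// => q.
by rewrite !primesM ?muln_gt0 ?p0//; case: (q \in primes p).
Qed.

Lemma sum_mobius_ln n : (0 < n)%N ->
  \sum_(d <- divisors n) mobius d * ln d%:R = - mangoldt n.
Proof.
move: n; apply: pfactor_ind => [|p a n pp pn n0 _].
  by rewrite (_ : divisors 1 = [:: 1%N])// big_seq1 ln1 mulr0 /mangoldt oppr0.
rewrite sum_divisors_pfactor// sum_divisors_mobius_pM// mangoldt_pfactor//.
rewrite -sumrB -[ln _ *+ _]mulr_natr -sum_mobius// mulr_sumr -sumrN.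
apply: eq_big_seq => d; rewrite -dvdn_divisors// => dn.
have d0 : (0 < d)%N by rewrite (dvdn_gt0 n0).
by rewrite natrM lnM ?posrE ?ltr0n ?d0 ?prime_gt0//; ring.
Qed.

(** The weight [ln (x / d)] isolates a term at [n = 1], which becomes the pole term of
    [sum_mangoldt_lsum0]. *)
Lemma sum_mobius_ln_div n x : (0 < n)%N -> 0 < x ->
  \sum_(d <- divisors n) mobius d * ln (x / d%:R) =
  ln x * (n == 1%N)%:R + mangoldt n.
Proof.
move=> n0 x0; rewrite -sum_mobius// -[mangoldt n]opprK -sum_mobius_ln//.
rewrite mulr_sumr -sumrB; apply: eq_big_seq => d.
rewrite -dvdn_divisors// => dn; rewrite ln_div ?posrE ?ltr0n ?(dvdn_gt0 n0)//.
by ring.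
Qed.

End ArithmeticFunctions.

(** * The estimates of Chebyshev and Mertens *)

Lemma bin_le_exp2 n k : ('C(n, k) <= 2 ^ n)%N.
Proof.
elim: n k => [|n IH] [|k]; rewrite ?bin0 ?expn_gt0 ?bin0n//.
by rewrite binS expnS mul2n -addnn leq_add.
Qed.

Section Estimates.
Variable R : realType.
Local Notation mangoldt := (mangoldt R).

Lemma ler_sum_nat_term (F : nat -> R) a b i : (a <= i < b)%N ->
  (forall j, (a <= j < b)%N -> 0 <= F j) -> F i <= \sum_(a <= j < b) F j.
Proof.
move=> iab F0; rewrite (bigD1_seq i) ?mem_index_iota ?iota_uniq//= lerDl.
by rewrite big_seq_cond sumr_ge0// => j /andP[]; rewrite mem_index_iota => /F0.
Qed.

(** Summation by parts: the differences of the weights are nonnegative and telescope, and together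
    with the last weight they add up to [w a]. *)
Lemma abel_bound (f w : nat -> R) a b C : (a <= b)%N ->
  (forall k, `|\sum_(a <= n < k) f n| <= C) ->
  (forall n, 0 <= w n) -> (forall n, (a <= n)%N -> w n.+1 <= w n) ->
  `|\sum_(a <= n < b) f n * w n| <= C * w a.
Proof.
move=> ab fC w0 wd; pose S k := \sum_(a <= n < k) f n.
have C0 : 0 <= C := le_trans (normr_ge0 _) (fC a).
have E : \sum_(a <= n < b) f n * w n =
    S b * w b + \sum_(a <= n < b) S n.+1 * (w n - w n.+1).
  elim: b ab => [|b IH].
    by rewrite leqn0 => /eqP ->; rewrite /S !big_geq// mul0r addr0.
  rewrite leq_eqVlt => /predU1P[<-|]; first by rewrite /S !big_geq// mul0r addr0.
  rewrite ltnS => ab; rewrite big_nat_recr//= IH//.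
  have Sb : S b.+1 = S b + f b by rewrite /S big_nat_recr.
  by rewrite [in RHS]big_nat_recr//= Sb; ring.
have T : \sum_(a <= n < b) (w n - w n.+1) = w a - w b.
  by rewrite -[LHS]opprK -sumrN; under eq_bigr do rewrite opprB;
     rewrite telescope_sumr// opprB.
rewrite E (le_trans (ler_normD _ _))//.
have -> : C * w a = C * w b + C * (w a - w b) by ring.
apply: lerD; first by rewrite normrM (ger0_norm (w0 b)) ler_wpM2r ?w0 ?fC.
rewrite -T mulr_sumr (le_trans (ler_norm_sum _ _ _))// ler_sum_nat// => n.
move=> /andP[an _]; rewrite normrM ler_pM ?fC// [leLHS]ger0_norm// subr_ge0.
exact: wd.
Qed.

Lemma ln_sub_le (x y : R) : 0 < x -> 0 < y -> ln x - ln y <= (x - y) / y.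
Proof.
move=> x0 y0; rewrite -ln_div ?posrE//.
have -> : x / y = 1 + (x - y) / y by field; rewrite gt_eqF.
by apply: le_ln1Dx; rewrite mulrBl divff ?gt_eqF//; have := divr_gt0 x0 y0; lra.
Qed.

Lemma lnS_sub_le n : (0 < n)%N -> ln n.+1%:R - ln n%:R <= n%:R^-1 :> R.
Proof.
move=> n0; rewrite (le_trans (ln_sub_le _ _)) ?ltr0n//.
by rewrite -natr1 addrAC subrr add0r mul1r.
Qed.

Lemma ln_nat_ge0 n : 0 <= ln n%:R :> R.
Proof. by case: n => [|n]; [rewrite ln0|rewrite ln_ge0// ler1n]. Qed.

Lemma ler_ln_nat m n : (0 < m)%N -> (m <= n)%N -> ln m%:R <= ln n%:R :> R.
Proof.
by move=> m0 mn; rewrite ler_ln ?posrE ?ltr0n ?ler_nat// (leq_trans m0).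
Qed.

Lemma ln_factS n : ln n.+1`!%:R = ln n.+1%:R + ln n`!%:R :> R.
Proof. by rewrite factS natrM lnM// posrE ltr0n ?fact_gt0. Qed.

Lemma ln_fact_ge n : n%:R * ln n%:R - n%:R <= ln n`!%:R :> R.
Proof.
elim: n => [|n IH]; first by rewrite fact0 ln1 mul0r subrr.
have [->|n0] := posnP n; first by rewrite (_ : 1`! = 1%N)// ln1; lra.
have h : n%:R * (ln n.+1%:R - ln n%:R) <= 1 :> R.
  by rewrite -ler_pdivlMl ?ltr0n// mulr1 lnS_sub_le.
by rewrite ln_factS; move: IH h; rewrite -(natr1 n); lra.
Qed.

Lemma ln_fact_le n : ln n`!%:R <= n%:R * ln n%:R :> R.
Proof.
elim: n => [|n IH]; first by rewrite fact0 ln1 mul0r.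
rewrite ln_factS.
have [->|n0] := posnP n; first by rewrite !(ln1, mulr0, addr0).
have h : n%:R * ln n%:R <= n%:R * ln n.+1%:R :> R.
  by rewrite ler_wpM2l ?ler_ln_nat.
have -> : n.+1%:R * ln n.+1%:R = n%:R * ln n.+1%:R + ln n.+1%:R :> R.
  by rewrite -{1}(natr1 n) mulrDl mul1r.
by lra.
Qed.

Lemma sum_ln_nat N : \sum_(1 <= n < N.+1) ln n%:R = ln N`!%:R :> R.
Proof.
elim: N => [|N IH]; first by rewrite big_geq// fact0 ln1.
by rewrite big_nat_recr//= IH ln_factS addrC.
Qed.

Lemma sum_mangoldt_divn N :
  \sum_(1 <= d < N.+1) mangoldt d * (N %/ d)%:R = ln N`!%:R.
Proof.
rewrite -sum_ln_nat; transitivity (\sum_(1 <= n < N.+1)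
    \sum_(d <- divisors n) mangoldt d).
  rewrite (sum_divisors_hyperbola (fun d _ => mangoldt d)).
  apply: eq_bigr => d _; rewrite big_const_nat subn1 /=.
  by rewrite iter_addr_0 mulr_natr.
by apply: eq_big_nat => n /andP[n0 _]; exact: sum_mangoldt.
Qed.

Definition psi N : R := \sum_(1 <= d < N.+1) mangoldt d.

(** By [sum_mangoldt_divn], the logarithm of the central binomial coefficient is the sum of
    [mangoldt d] times [(2n %/ d) - 2 (n %/ d)]. These factors are nonnegative, and they are at
    least 1 for [n < d <= 2n]. *)
Lemma psi_double n : psi n.*2 - psi n <= n.*2%:R.
Proof.
have nn2 : (n <= n.*2)%N by rewrite -addnn leq_addr.
have nn : (n.+1 <= n.*2.+1)%N by [].
apply: (@le_trans _ _ (ln n.*2`!%:R - ln n`!%:R *+ 2)); last first.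
  have e : ('C(n.*2, n) * (n`! * n`!))%N = n.*2`!.
    have := @bin_fact n.*2 n; rewrite (_ : (n.*2 - n)%N = n); last first.
      by rewrite -addnn addnK.
    exact.
  rewrite -e natrM natrM !lnM ?posrE ?mulr_gt0 ?ltr0n ?bin_gt0 ?fact_gt0//.
  rewrite mulr2n addrK (@le_trans _ _ (ln (2 ^ n.*2)%:R))//.
    by rewrite ler_ln_nat ?bin_le_exp2// bin_gt0.
  rewrite natrX lnXn// -[leLHS]mulr_natl ler_piMr//.
  by have := @le_ln1Dx R 1; rewrite -[1 + 1]/2%:R => ->//; lra.
rewrite -!sum_mangoldt_divn /psi.
rewrite (big_cat_nat (n := n.+1))//= addrAC subrr add0r.
rewrite [X in _ <= _ - X *+ 2](_ : _ =
    \sum_(1 <= d < n.*2.+1) mangoldt d * (n %/ d)%:R); last first.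
  rewrite [RHS](big_cat_nat (n := n.+1))//= [X in _ = _ + X]big_nat.
  rewrite [X in _ = _ + X]big1 ?addr0// => d /andP[dn _].
  by rewrite divn_small ?mulr0.
rewrite -sumrMnl -sumrB [leRHS](big_cat_nat (n := n.+1))//=.
rewrite -[leLHS]add0r lerD//.
  apply: sumr_ge0 => d _; rewrite -mulrnAr -mulrBr mulr_ge0 ?mangoldt_ge0//.
  rewrite subr_ge0 -mulrnA ler_nat.
  have [->|d0] := posnP d; first by rewrite !divn0.
  by rewrite leq_divRL// muln2 -!addnn mulnDl leq_add ?leq_trunc_div.
apply: ler_sum_nat => d /andP[nd d2]; rewrite [(n %/ d)%N]divn_small//.
rewrite mulr0 mul0rn subr0 ler_peMr ?mangoldt_ge0// ler1n divn_gt0.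
  by rewrite -ltnS.
exact: leq_ltn_trans nd.
Qed.

(** Halving: for [h = N./2], [psi_double] and induction give [psi (2h) <= 6h]; an odd [N] adds at
    most [N], for a total of [8h + 1]. *)
Lemma psi_le N : psi N <= 4 * N%:R.
Proof.
elim/ltn_ind: N => N IH.
have [->|N0] := posnP N; first by rewrite /psi big_geq// mulr0.
have half : (N./2 < N)%N by rewrite ltn_half_double -addnn -{1}[N]addn0 ltn_add2l.
have := IH _ half; have := psi_double N./2.
have E := odd_double_half N; set h := N./2 in E half *.
have h0 : 0 <= h%:R :> R by [].
have -> : h.*2%:R = 2 * h%:R :> R by rewrite -mul2n natrM.
have ER : N%:R = (odd N)%:R + 2 * h%:R :> R by rewrite -natrM -natrD mul2n E.
have [o|/negbTE o] := boolP (odd N); last first.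
  have -> : psi N = psi h.*2 by rewrite -{1}E o.
  by rewrite ER o /= mulr0n; lra.
have -> : psi N = psi h.*2 + mangoldt N.
  by rewrite /psi -[in LHS]E -[in X in _ = _ + X]E o add1n big_nat_recr.
have : mangoldt N <= N%:R.
  apply: (@le_trans _ _ (ln N%:R)).
    rewrite -sum_mangoldt// (bigD1_seq N) ?divisors_uniq -?dvdn_divisors//=.
    by rewrite lerDl sumr_ge0// => *; exact: mangoldt_ge0.
  by rewrite ltW// ln_sublinear ?ltr0n.
by rewrite ER o /= mulr1n; lra.
Qed.

Lemma divn_ler N d : (0 < d)%N -> (N %/ d)%:R <= N%:R / d%:R :> R.
Proof. by move=> d0; rewrite ler_pdivlMr ?ltr0n// -natrM ler_nat leq_trunc_div. Qed.

Lemma ltr_divnS N d : (0 < d)%N -> N%:R / d%:R < (N %/ d).+1%:R :> R.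
Proof. by move=> d0; rewrite ltr_pdivrMr ?ltr0n// -natrM ltr_nat ltn_ceil. Qed.

(** In [sum_mangoldt_divn], replacing [N %/ d] by [N / d] costs at most [psi N <= 4 N]; then divide
    by [N]. *)
Lemma mertens N : (0 < N)%N ->
  `|\sum_(1 <= d < N.+1) mangoldt d / d%:R - ln N%:R| <= 4.
Proof.
move=> N0; set S := \sum_(_ <= _ < _) _; have N0' : 0 < N%:R :> R by rewrite ltr0n.
have lo : ln N`!%:R <= N%:R * S.
  rewrite -sum_mangoldt_divn mulr_sumr; apply: ler_sum_nat => d /andP[d0 _].
  rewrite mulrCA ler_wpM2l ?mangoldt_ge0//; exact: divn_ler.
have up : N%:R * S <= ln N`!%:R + psi N.
  rewrite -sum_mangoldt_divn -big_split mulr_sumr/=.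
  apply: ler_sum_nat => d /andP[d0 _].
  rewrite mulrCA -[X in _ <= _ + X]mulr1 -mulrDr ler_wpM2l ?mangoldt_ge0//.
  by rewrite natr1 ltW// ltr_divnS.
have u4 : N%:R * S <= N%:R * (ln N%:R + 4).
  by have := psi_le N; have := ln_fact_le N; lra.
have l4 : N%:R * (ln N%:R - 1) <= N%:R * S by have := ln_fact_ge N; lra.
move: u4 l4; rewrite !ler_pM2l// => u4 l4.
by rewrite ler_norml; apply/andP; split; lra.
Qed.

Lemma sum_expV_le (x : R) K : 1 < x ->
  \sum_(2 <= k < K) (x ^+ k)^-1 <= (x * (x - 1))^-1.
Proof.
move=> x1; have x0 : 0 < x by lra.
have y0 : 0 < x - 1 by lra.
have [K2|/ltnW K2] := leqP K 2.
  by rewrite big_geq// invr_ge0 mulr_ge0// ltW.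
rewrite -(subnK K2); elim: (K - 2)%N => [|j IH].
  by rewrite big_geq// invr_ge0 mulr_ge0// ltW.
suff -> : \sum_(2 <= k < (j.+1 + 2)%N) (x ^+ k)^-1 =
    (x * (x - 1))^-1 * (1 - (x ^+ j.+1)^-1).
  by rewrite ler_piMr ?gerBl ?invr_ge0 ?exprn_ge0 ?mulr_ge0 ?ltW.
elim: {IH} j => [|j IH].
  by rewrite big_nat1 expr1 expr2; field; rewrite !gt_eqF.
rewrite addSn big_nat_recr; last by rewrite addn2.
rewrite /= IH addn2 !exprS; field.
by rewrite !gt_eqF// exprn_gt0.
Qed.

(** The function [(ln n + 2) / n] serves twice: its differences dominate this summand, so that the
    sum telescopes, and it decreases from [n = 1] on, unlike [ln n / n]. *)
Lemma ln_div_sqr_le n : (1 < n)%N ->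
  ln n%:R / (n%:R * (n%:R - 1)) <=
  (ln n.-1%:R + 2) / n.-1%:R - (ln n%:R + 2) / n%:R :> R.
Proof.
case: n => [|[|n]]// _ /=.
have := @lnS_sub_le n.+1 isT.
have : 1 <= n.+1%:R :> R by rewrite ler1n.
have -> : n.+2%:R = n.+1%:R + 1 :> R by rewrite natr1.
move: (n.+1%:R : R) => y; move: (ln (y + 1)) (ln y) => a b y1 ab.
have y0 : 0 < y by lra.
have z0 : 0 < y + 1 by lra.
rewrite addrK -subr_ge0.
have -> : (b + 2) / y - (a + 2) / (y + 1) - a / ((y + 1) * y) =
   (y^-1 - (a - b)) / y + (y - 1) / (y ^+ 2 * (y + 1)).
  by field; rewrite !gt_eqF.
by rewrite addr_ge0// divr_ge0 ?mulr_ge0 ?exprn_ge0 ?subr_ge0// ltW.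
Qed.

Lemma sum_ln_div_sqr N :
  \sum_(2 <= n < N) ln n%:R / (n%:R * (n%:R - 1)) <= 2 :> R.
Proof.
have [N2|N2] := leqP N 2; first by rewrite big_geq.
pose G n : R := (ln n%:R + 2) / n%:R.
apply: (@le_trans _ _ (\sum_(2 <= n < N) (G n.-1 - G n))).
  by apply: ler_sum_nat => n /andP[n1 _]; exact: ln_div_sqr_le.
rewrite -[N]prednK; last by rewrite (ltn_trans _ N2).
rewrite big_add1 /= -[leLHS]opprK -sumrN.
under eq_bigr do rewrite opprB.
rewrite telescope_sumr; last by rewrite -ltnS prednK// (ltn_trans _ N2).
rewrite opprB /G ln1 add0r divr1 gerBl.
by rewrite divr_ge0// addr_ge0// ln_nat_ge0.
Qed.

Lemma sum_mangoldt_nonprime N :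
  \sum_(1 <= n < N.+1 | ~~ prime n) mangoldt n / n%:R <= 2.
Proof.
(* Here [p] runs over all integers from 2 on, not only primes; the surplus terms are nonnegative,
   and the sum over [k] is geometric. *)
pose T (n : nat) := \sum_(2 <= p < N.+1) \sum_(2 <= k < N.+1)
  (if (n == p ^ k)%N then ln p%:R / n%:R else 0 : R).
have t0 (n p k : nat) : 0 <= (if (n == p ^ k)%N then ln p%:R / n%:R else 0 : R).
  by case: ifP => // _; rewrite divr_ge0// ln_nat_ge0.
have T0 n : 0 <= T n by rewrite sumr_ge0// => p _; rewrite sumr_ge0.
apply: (@le_trans _ _ (\sum_(1 <= n < N.+1) T n)).
  rewrite big_mkcond; apply: ler_sum_nat => n /andP[n0 nN].
  case: ifP => // np; rewrite {1}/mangoldt.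
  case E: (primes n) => [|p []]; rewrite ?mul0r//.
  have [pp pn] : prime p /\ (p %| n)%N.
    have : p \in primes n by rewrite E inE.
    by rewrite mem_primes => /and3P[].
  have p1 := prime_gt1 pp.
  have def : n = (p ^ logn p n)%N.
    rewrite {1}(prod_prime_decomp n0) prime_decompE E /= big_seq1//.
  set k := logn p n in def.
  have k2 : (1 < k)%N.
    rewrite ltnNge; apply/negP => k1; move: np; rewrite def.
    case: k k1 def => [|[|//]] _ def; last by rewrite expn1 pp.
    by move: E; rewrite def.
  have pN : (1 < p < N.+1)%N by rewrite p1 (leq_ltn_trans _ nN)// dvdn_leq.
  have kN : (1 < k < N.+1)%N.
    by rewrite k2 (leq_trans _ nN)// ltnS ltnW// def ltn_expl.
  apply: le_trans (ler_sum_nat_term pN _); last by move=> q _; rewrite sumr_ge0.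
  apply: le_trans (ler_sum_nat_term kN _); last by [].
  by rewrite -def eqxx.
rewrite exchange_big_nat/=; apply: le_trans (sum_ln_div_sqr N.+1).
apply: ler_sum_nat => p /andP[p1 _].
rewrite exchange_big_nat/=.
have p1' : 1 < p%:R :> R by rewrite ltr1n.
apply: le_trans (ler_wpM2l (ln_nat_ge0 p) (sum_expV_le N.+1 p1')).
rewrite mulr_sumr; apply: ler_sum_nat => k _.
rewrite -natrX.
have [h|h] := boolP ((p ^ k)%N \in index_iota 1 N.+1).
  rewrite (bigD1_seq _ h) ?iota_uniq//= eqxx big1 ?addr0//.
  by move=> n /negbTE ->.
rewrite big_seq_cond big1; first by rewrite mulr_ge0 ?invr_ge0 ?ln_nat_ge0.
by move=> n /andP[ni _]; case: eqP => // e; rewrite -e ni in h.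
Qed.

End Estimates.

(** * Series over balanced periodic functions *)

Section Balanced.
Variables (R : realType) (m : nat).
Hypothesis m_gt0 : (0 < m)%N.
Local Notation mangoldt := (mangoldt R).
Local Notation mobius := (mobius R).
Implicit Types f g : nat -> R.

(** The real functions in the span of the nonprincipal Dirichlet characters modulo [m], described
    without characters. *)
Definition balanced f :=
  [/\ forall n, f (n + m)%N = f n, forall n, ~~ coprime n m -> f n = 0
    & \sum_(i < m) f i = 0].

Definition dilate d f : nat -> R := fun n => f (d * n)%N.

Lemma periodic_mod f n : (forall n, f (n + m)%N = f n) -> f n = f (n %% m)%N.
Proof.
move=> fm; rewrite {1}(divn_eq n m) addnC; elim: (n %/ m)%N => [|q IH].
  by rewrite addn0.
by rewrite mulSn addnCA addnC fm.
Qed.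

Lemma periodic_dilate f d n : (forall n, f (n + m)%N = f n) ->
  dilate d f (n + m)%N = dilate d f n.
Proof.
move=> fm; rewrite /dilate mulnDr; elim: d (d * n)%N => [|d IH] k.
  by rewrite addn0.
by rewrite mulSn addnA IH fm.
Qed.

Lemma sum_dilate f d : (forall n, f (n + m)%N = f n) -> coprime d m ->
  \sum_(i < m) dilate d f i = \sum_(i < m) f i.
Proof.
move=> fm dm; pose h (i : 'I_m) : 'I_m := Ordinal (ltn_pmod (d * i) m_gt0).
have h_inj : injective h.
  move=> i j /(congr1 val) /= /eqP hij; apply: val_inj => /=.
  wlog ij : i j hij / (i <= j)%N.
    by move=> w; case: (leqP i j) => [/w|/ltnW/w] => [->//|<-//]; rewrite eq_sym.
  move: hij; rewrite eq_sym eqn_mod_dvd ?leq_mul2l ?ij ?orbT// -mulnBr.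
  rewrite Gauss_dvdr 1?coprime_sym// => /dvdn_leq; rewrite subn_gt0.
  case: (ltngtP i j) ij => // ij _ /(_ isT); rewrite leqNgt => /negP[].
  by rewrite (leq_ltn_trans _ (ltn_ord j))// leq_subr.
rewrite [RHS](reindex_inj h_inj) /=; apply: eq_bigr => i _.
by rewrite /dilate periodic_mod.
Qed.

Lemma balanced_dilate d f : balanced f -> balanced (dilate d f).
Proof.
move=> [fm fc f0]; split.
- by move=> n; exact: periodic_dilate.
- by move=> n nc; apply: fc; rewrite coprimeMl negb_and nc orbT.
- have [dc|dc] := boolP (coprime d m); first by rewrite sum_dilate.
  by rewrite big1// => i _; apply: fc; rewrite coprimeMl negb_and dc.
Qed.

Definition normsum f : R := \sum_(i < m) `|f i|.

Lemma normsum_ge0 f : 0 <= normsum f.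
Proof. exact: sumr_ge0. Qed.

Lemma normsum_dilate d f : balanced f -> normsum (dilate d f) <= normsum f.
Proof.
move=> [fm fc _]; have [dc|dc] := boolP (coprime d m).
  suff -> : normsum f = \sum_(i < m) dilate d (fun n => `|f n|) i by [].
  by rewrite sum_dilate// => n; rewrite fm.
rewrite [leLHS]big1 ?normsum_ge0// => i _.
by rewrite /dilate fc ?normr0// coprimeMl negb_and dc.
Qed.

Lemma balanced_psum f k : balanced f -> `|\sum_(0 <= n < k) f n| <= normsum f.
Proof.
move=> [fm _ f0]; elim/ltn_ind: k => k IH.
have [km|mk] := ltnP k m.
  rewrite (le_trans (ler_norm_sum _ _ _))//.
  suff -> : normsum f = \sum_(0 <= n < m) `|f n|.
    by rewrite [leRHS](big_cat_nat (n := k)) ?(ltnW km)//= lerDl sumr_ge0.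
  by rewrite big_mkord.
rewrite -(subnK mk) addnC (big_cat_nat (n := m)) ?leq_addr//=.
rewrite [X in X + _]big_mkord f0 add0r -{1}[m]add0n big_addn addKn.
by under eq_bigr do rewrite fm; rewrite IH// ltn_subrL m_gt0 (leq_trans m_gt0).
Qed.

Lemma balanced_sum_nat f a k : balanced f ->
  `|\sum_(a <= n < k) f n| <= 2 * normsum f.
Proof.
move=> bf; have [ka|ak] := leqP k a.
  by rewrite big_geq// normr0 mulr_ge0// normsum_ge0.
have -> : \sum_(a <= n < k) f n =
    \sum_(0 <= n < k) f n - \sum_(0 <= n < a) f n.
  by rewrite [X in X - _](big_cat_nat (n := a)) ?(ltnW ak)//= addrAC subrr add0r.
by rewrite (le_trans (ler_normB _ _))// mulr_natl mulr2n lerD// balanced_psum.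
Qed.

Definition hsum f N : R := \sum_(1 <= n < N.+1) f n / n%:R.

(** For a nonprincipal character this is [L(1, f)]. The term of index 0 vanishes, the inverse of
    zero being zero. *)
Definition lsum f : R := limn (series (fun n => f n / n%:R)).

Lemma hsumE f N : hsum f N = series (fun n => f n / n%:R) N.+1.
Proof.
by rewrite /series /= big_ltn// invr0 mulr0 add0r.
Qed.

Lemma hsum_tail f a b : balanced f -> (a <= b)%N ->
  `|hsum f b - hsum f a| <= 2 * normsum f / a.+1%:R.
Proof.
move=> bf ab; rewrite /hsum (big_cat_nat (n := a.+1))//= addrAC subrr add0r.
apply: (abel_bound (w := fun n => n%:R^-1)) => //.
- by move=> k; exact: balanced_sum_nat.
- by move=> n; rewrite invr_ge0.
- by move=> n an; rewrite lef_pV2 ?posrE ?ltr0n// ?ler_nat// (leq_trans _ an).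
Qed.

Lemma archi_lt (c e : R) : 0 < e -> exists N, forall n, (N <= n)%N ->
  c / n.+1%:R < e.
Proof.
move=> e0; exists (Num.bound (`|c| / e)) => n Nn.
rewrite ltr_pdivrMr ?ltr0n// mulrC -ltr_pdivrMr//.
apply: (@le_lt_trans _ _ (`|c| / e)).
  by rewrite ler_pM2r ?invr_gt0// ler_norm.
apply: (lt_le_trans (archi_boundP _)); first by rewrite divr_ge0// ltW.
by rewrite ler_nat leqW.
Qed.

Lemma cvg_lsum f : balanced f -> series (fun n => f n / n%:R) @ \oo --> lsum f.
Proof.
move=> bf; apply/cauchy_cvgP; apply: cauchy_exP => e e0.
have [N hN] := archi_lt (2 * normsum f) e0.
exists (hsum f N); exists N.+1 => // -[//|n] /= Nn.
rewrite -ball_normE /= distrC -hsumE (le_lt_trans (@hsum_tail f N n bf Nn))//.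
exact: hN.
Qed.

Lemma lsum_tail f N : balanced f ->
  `|lsum f - hsum f N| <= 2 * normsum f / N.+1%:R.
Proof.
move=> bf; apply/ler_addgt0Pr => e e0.
have /cvgrPdist_lt/(_ _ e0)[M _ hM] := cvg_lsum bf.
have := hM (maxn M N).+1 (leqW (leq_maxl M N)); rewrite -hsumE => h1.
have := hsum_tail bf (leq_maxr M N) => h2.
rewrite -(subrK (hsum f (maxn M N)) (lsum f)) -addrA.
by rewrite (le_trans (ler_normD _ _))// [leRHS]addrC lerD// ltW.
Qed.

Lemma lsum_unique f l c : balanced f ->
  (forall N, `|l - hsum f N| <= c / N.+1%:R) -> lsum f = l.
Proof.
move=> bf h; apply/eqP; rewrite -subr_eq0 -normr_le0; apply/ler_addgt0Pr => e e0.
rewrite add0r; have [N /(_ _ (leqnn _)) hN] := archi_lt (2 * normsum f + c) e0.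
apply: le_trans (ltW hN); rewrite -(subrK (hsum f N) (lsum f)) -addrA mulrDl.
by rewrite (le_trans (ler_normD _ _))// lerD ?lsum_tail// distrC.
Qed.

Lemma balanced_sum (I : finType) (c : I -> R) (F : I -> nat -> R) :
  (forall i, balanced (F i)) -> balanced (fun n => \sum_i c i * F i n).
Proof.
move=> bF; split=> [n|n nc|].
- by apply: eq_bigr => i _; have [-> _ _] := bF i.
- by rewrite big1// => i _; have [_ -> //] := bF i; rewrite mulr0.
- rewrite exchange_big/= big1// => i _.
  by rewrite -mulr_sumr; have [_ _ ->] := bF i; rewrite mulr0.
Qed.

Lemma lsum_sum (I : finType) (c : I -> R) (F : I -> nat -> R) :
  (forall i, balanced (F i)) ->
  lsum (fun n => \sum_i c i * F i n) = \sum_i c i * lsum (F i).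
Proof.
move=> bF; apply: (@lsum_unique _ _ (\sum_i `|c i| * (2 * normsum (F i)))).
  exact: balanced_sum.
move=> N; have -> : hsum (fun n => \sum_i c i * F i n) N =
    \sum_i c i * hsum (F i) N.
  rewrite /hsum; under [RHS]eq_bigr do rewrite mulr_sumr.
  rewrite exchange_big/=; apply: eq_bigr => n _; rewrite mulr_suml.
  by apply: eq_bigr => i _; rewrite mulrA.
rewrite -sumrB mulr_suml (le_trans (ler_norm_sum _ _ _))// ler_sum// => i _.
by rewrite -mulrBr normrM -mulrA ler_wpM2l// lsum_tail.
Qed.

Lemma divSn_ler N d : (0 < d)%N -> (0 < N)%N ->
  (N %/ d).+1%:R^-1 <= d%:R / N%:R :> R.
Proof.
move=> d0 N0; rewrite -[leRHS]invrK lef_pV2 ?posrE ?invr_gt0 ?divr_gt0 ?ltr0n//.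
by rewrite invf_div ltW// ltr_divnS.
Qed.

(** Uniform in [d], since dilation does not increase [normsum]. Weighted by [mangoldt d / d], the
    errors [d / N] add up to [psi N / N], which is bounded. *)
Lemma lsum_tail_dilate f N d : balanced f -> (0 < d)%N -> (0 < N)%N ->
  `|lsum (dilate d f) - hsum (dilate d f) (N %/ d)| <=
  2 * normsum f * (d%:R / N%:R).
Proof.
move=> bf d0 N0; rewrite (le_trans (lsum_tail _ (balanced_dilate d bf)))//.
rewrite ler_pM ?mulr_ge0 ?invr_ge0 ?normsum_ge0 ?divSn_ler//.
by rewrite ler_wpM2l ?normsum_dilate.
Qed.

(** As [ln n / n] is not monotone at first, partial summation is applied to [(ln n + 2) / n] and to
    [2 / n], each costing [4 * normsum f]. *)
Lemma balanced_ln_div f N : balanced f ->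
  `|\sum_(1 <= n < N.+1) f n * (ln n%:R / n%:R)| <= 8 * normsum f.
Proof.
move=> bf; have -> : \sum_(1 <= n < N.+1) f n * (ln n%:R / n%:R) =
    \sum_(1 <= n < N.+1) f n * ((ln n%:R + 2) / n%:R) -
    2 * \sum_(1 <= n < N.+1) f n * n%:R^-1.
  by rewrite mulr_sumr -sumrB; apply: eq_bigr => n _; ring.
rewrite (le_trans (ler_normB _ _))// (_ : 8 * normsum f =
  2 * normsum f * ((ln 1%:R + 2) / 1%:R) + 2 * (2 * normsum f * 1%:R^-1)).
  rewrite lerD//.
    apply: (abel_bound (w := fun n => (ln n%:R + 2) / n%:R)) => //.
    - by move=> k; exact: balanced_sum_nat.
    - by move=> n; rewrite divr_ge0// addr_ge0// ln_nat_ge0.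
    - move=> n n1; rewrite -subr_ge0 (le_trans _ (@ln_div_sqr_le _ n.+1 _))//.
      by rewrite divr_ge0 ?ln_nat_ge0// mulr_ge0// subr_ge0 ler1n.
  rewrite normrM ger0_norm// ler_wpM2l//.
  apply: (abel_bound (w := fun n => n%:R^-1)) => //.
  - by move=> k; exact: balanced_sum_nat.
  - by move=> n; rewrite invr_ge0.
  - by move=> n n1; rewrite lef_pV2 ?posrE ?ltr0n ?ler_nat.
by rewrite ln1 invr1; ring.
Qed.

(** As [ln] is the divisor sum of [mangoldt], the sum of [f n * ln n / n] unfolds into the
    [hsum (dilate d f) (N %/ d)] weighted by [mangoldt d / d]. Passing from [hsum] to [lsum] costs
    another [8 * normsum f]. *)
Lemma sum_mangoldt_lsum f : balanced f -> exists C, forall N,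
  `|\sum_(1 <= d < N.+1) mangoldt d / d%:R * lsum (dilate d f)| <= C.
Proof.
move=> bf; exists (16 * normsum f) => N.
have B0 := normsum_ge0 f.
have [->|N0] := posnP N; first by rewrite big_geq// normr0 mulr_ge0.
have E : \sum_(1 <= n < N.+1) f n * (ln n%:R / n%:R) =
    \sum_(1 <= d < N.+1) mangoldt d / d%:R * hsum (dilate d f) (N %/ d).
  pose F (d k : nat) : R := mangoldt d * (f (d * k)%N / (d * k)%:R).
  transitivity (\sum_(1 <= n < N.+1) \sum_(d <- divisors n) F d (n %/ d)%N).
    apply: eq_big_nat => n /andP[n0 _].
    rewrite -(sum_mangoldt R n0) mulrA [f n * _]mulrC -mulrA mulr_suml.
    apply: eq_big_seq => d; rewrite -dvdn_divisors// => dn.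
    by rewrite /F mulnC divnK.
  rewrite sum_divisors_hyperbola; apply: eq_big_nat => d /andP[d0 _].
  rewrite /hsum mulr_sumr; apply: eq_bigr => k _.
  by rewrite /F /dilate natrM invfM; ring.
have := balanced_ln_div N bf; rewrite E => h1.
rewrite -(subrK (\sum_(1 <= d < N.+1) mangoldt d / d%:R *
   hsum (dilate d f) (N %/ d)) (\sum_(_ <= _ < _) _)).
rewrite (le_trans (ler_normD _ _))// (_ : 16 * normsum f =
  8 * normsum f + 8 * normsum f); last by ring.
rewrite lerD// -sumrB (le_trans (ler_norm_sum _ _ _))//.
apply: (@le_trans _ _ (\sum_(1 <= d < N.+1)
    2 * normsum f / N%:R * mangoldt d)).
  apply: ler_sum_nat => d /andP[d0 _].
  rewrite -mulrBr normrM ger0_norm ?divr_ge0 ?mangoldt_ge0//.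
  apply: le_trans (ler_wpM2l _ (lsum_tail_dilate bf d0 N0)) _.
    by rewrite divr_ge0 ?mangoldt_ge0.
  rewrite le_eqVlt; apply/orP; left; apply/eqP; field.
  by rewrite !pnatr_eq0 -!lt0n d0 N0.
rewrite -mulr_sumr -/(psi R N) mulrAC ler_pdivrMr ?ltr0n//.
by have := ler_wpM2l B0 (psi_le R N); lra.
Qed.

(* Moebius inversion turns the vanishing of all [lsum (dilate d f)] into a pole
   of [-L'/L] type: the sum over [mangoldt] has main term [- f 1 * ln N]. *)
Lemma sum_mangoldt_lsum0 f : balanced f -> (forall d, lsum (dilate d f) = 0) ->
  exists C, forall N, (0 < N)%N ->
  `|\sum_(1 <= n < N.+1) mangoldt n / n%:R * f n + f 1%N * ln N%:R| <= C.
Proof.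
move=> bf f0; exists (2 * normsum f) => N N0.
have B0 := normsum_ge0 f; have N0' : 0 < N%:R :> R by rewrite ltr0n.
pose F (d k : nat) : R :=
  mobius d * ln (N%:R / d%:R) * (f (d * k)%N / (d * k)%:R).
have -> : \sum_(1 <= n < N.+1) mangoldt n / n%:R * f n + f 1%N * ln N%:R =
    \sum_(1 <= n < N.+1) \sum_(d <- divisors n) F d (n %/ d)%N.
  transitivity (\sum_(1 <= n < N.+1) f n / n%:R *
      (ln N%:R * (n == 1%N)%:R + mangoldt n)).
    under [RHS]eq_bigr do rewrite mulrDr.
    rewrite big_split /= [RHS]addrC; congr (_ + _).
      by apply: eq_bigr => n _; ring.
    rewrite big_ltn// big_nat big1 ?addr0 ?eqxx ?mulr1 ?divr1//.
    by move=> n /andP[n1 _]; rewrite gtn_eqF// !mulr0.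
  apply: eq_big_nat => n /andP[n0 _].
  rewrite -(sum_mobius_ln_div n0 N0') mulr_sumr.
  apply: eq_big_seq => d; rewrite -dvdn_divisors// => dn.
  by rewrite /F mulnC divnK// mulrC.
rewrite sum_divisors_hyperbola (le_trans (ler_norm_sum _ _ _))//.
apply: (@le_trans _ _ (\sum_(1 <= d < N.+1)
   2 * normsum f / N%:R * (ln N%:R - ln d%:R))).
  apply: ler_sum_nat => d /andP[d0 dN].
  have -> : \sum_(1 <= k < (N %/ d).+1) F d k =
      mobius d * (ln (N%:R / d%:R) / d%:R * hsum (dilate d f) (N %/ d)).
    rewrite /hsum !mulr_sumr; apply: eq_bigr => k _.
    by rewrite /F /dilate natrM invfM; ring.
  rewrite ln_div ?posrE ?ltr0n// normrM.
  apply: le_trans (ler_piMl _ (norm_mobius R d)) _ => //.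
  have ld : 0 <= ln N%:R - ln d%:R :> R by rewrite subr_ge0 ler_ln_nat.
  rewrite normrM ger0_norm ?divr_ge0//.
  have := lsum_tail_dilate bf d0 N0; rewrite f0 sub0r normrN => h.
  apply: le_trans (ler_wpM2l _ h) _; first by rewrite divr_ge0.
  rewrite le_eqVlt; apply/orP; left; apply/eqP; field.
  by rewrite !pnatr_eq0 -!lt0n d0 N0.
rewrite -mulr_sumr sumrB sum_ln_nat big_const_nat subn1 /= iter_addr_0.
rewrite mulrAC ler_pdivrMr// ler_wpM2l ?mulr_ge0// -[ln _ *+ _]mulr_natl.
by have := ln_fact_ge R N; lra.
Qed.

(** Compared with [mertens], the only losses are among non-primes, of total weight at most 2, and
    primes dividing [m], which are at most [m]. *)
Lemma mertens_coprime : exists C, forall N, (0 < N)%N ->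
  `|\sum_(1 <= n < N.+1) mangoldt n / n%:R * (coprime n m)%:R - ln N%:R| <= C.
Proof.
exists (6 + \sum_(1 <= n < m.+1) mangoldt n / n%:R) => N N0.
have t0 n : 0 <= mangoldt n / n%:R by rewrite divr_ge0 ?mangoldt_ge0.
have := mertens R N0; have := sum_mangoldt_nonprime R N.
set S := \sum_(1 <= n < N.+1) mangoldt n / n%:R * (coprime n m)%:R.
set P := \sum_(1 <= n < N.+1) mangoldt n / n%:R.
set Q := \sum_(1 <= n < N.+1 | ~~ prime n) mangoldt n / n%:R.
set M := \sum_(1 <= n < m.+1) mangoldt n / n%:R => Q2.
have PS : S <= P.
  by apply: ler_sum_nat => n _; rewrite ler_piMr//; case: coprime.
suff SP : P <= S + Q + M by rewrite !ler_norml => /andP[? ?]; apply/andP; split; lra.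
have -> : M = \sum_(1 <= n < (maxn N m).+1)
    (if (n <= m)%N then mangoldt n / n%:R else 0).
  rewrite [RHS](big_cat_nat (n := m.+1)) ?ltnS ?leq_maxr//= [X in _ = _ + X]big_nat.
  rewrite [X in _ = _ + X]big1 ?addr0//; last first.
    by move=> n /andP[mn _]; rewrite leqNgt mn.
  by apply: eq_big_nat => n /andP[_]; rewrite ltnS => ->.
apply: (@le_trans _ _ (S + Q + \sum_(1 <= n < N.+1)
    (if (n <= m)%N then mangoldt n / n%:R else 0))); last first.
  rewrite lerD2l [leRHS](big_cat_nat (n := N.+1)) ?ltnS ?leq_maxl//= lerDl.
  by rewrite sumr_ge0// => n _; case: ifP.
rewrite /S /Q [X in _ <= _ + X + _]big_mkcond -!big_split /=.
apply: ler_sum_nat => n /andP[n0 _].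
have [np|np] := boolP (prime n); last first.
  rewrite addrAC lerDr addr_ge0//; first by rewrite mulr_ge0.
  by case: ifP.
rewrite addr0 prime_coprime//; have [nm|nm] := boolP (n %| m)%N.
  by rewrite (dvdn_leq m_gt0 nm) mulr0 add0r.
by rewrite mulr1 lerDl; case: ifP.
Qed.

End Balanced.

(** * Non-vanishing for real characters *)

Lemma bernoulli_le (R : realDomainType) (x : R) n : -1 <= x ->
  1 + n%:R * x <= (1 + x) ^+ n.
Proof.
move=> x1; elim: n => [|n IH]; first by rewrite mul0r addr0 expr0.
have x0 : 0 <= 1 + x by lra.
rewrite exprS (le_trans _ (ler_wpM2l x0 IH))// -(natr1 n).
have := mulr_ge0 (ler0n R n) (sqr_ge0 x); rewrite expr2; lra.
Qed.

Section GeometricSum.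
Variables (R : realType) (u : R).
Hypotheses (u0 : 0 < u) (u1 : u < 1).
(* With [t] a square, the AM-GM bound [n t^((n-1)/2) <= 1 + ... + t^(n-1)]
   involves no square root. *)
Let t := u ^+ 2.

Let t0 : 0 < t. Proof. exact: exprn_gt0. Qed.
Let t1 : t < 1. Proof. by rewrite /t expr_lt1 ?ltW. Qed.

Definition geosum n : R := \sum_(i < n) t ^+ i.

Lemma geosumE n : (1 - t) * geosum n = 1 - t ^+ n.
Proof. by rewrite -opprB mulNr -subrX1 opprB. Qed.

(** Without its two extreme terms the sum is [t] times a shorter one, and the extreme terms satisfy
    [1 + x ^ 2 >= 2 x] for the relevant power [x] of [u]. *)
Lemma geosum_ge n : n.+1%:R * u ^+ n <= geosum n.+1.
Proof.
elim/ltn_ind: n => -[|[|n]] IH.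
- by rewrite /geosum big_ord1 expr0 mulr1.
- rewrite /geosum !big_ord_recl big_ord0 addr0 expr0 expr1 /t -subr_ge0.
  by have := sqr_ge0 (1 - u); rewrite !expr2 expr1; lra.
have -> : geosum n.+3 = 1 + t * geosum n.+1 + (u ^+ n.+2) ^+ 2.
  rewrite /geosum big_ord_recl big_ord_recr /= expr0 mulr_sumr addrA; congr (_ + _).
    by congr (_ + _); apply: eq_bigr => i _; rewrite /bump /= add1n exprS.
  by rewrite /bump /= add1n /t -!exprM mulnC.
have := ler_wpM2l (ltW t0) (IH n (leqnSn _)).
have -> : u ^+ n.+2 = t * u ^+ n by rewrite /t -exprD.
have := sqr_ge0 (1 - t * u ^+ n); rewrite -(natr1 n.+2) -(natr1 n.+1) !expr2.
by move: (u ^+ n) (n.+1%:R : R) (geosum n.+1) (t) => a b s y; lra.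
Qed.

Lemma geosum_ge1 n : (0 < n)%N -> 1 <= geosum n.
Proof.
case: n => // n _; rewrite /geosum big_ord_recl expr0 lerDl sumr_ge0// => i _.
by rewrite exprn_ge0// ltW.
Qed.

(* [1 - t] times [1 / (n (1 - t)) - t^n / (1 - t^n)], the difference between the
   Lambert series of [chi] and [L(1, chi) / (1 - t)]. *)
Definition lambert_weight n : R := n%:R^-1 - t ^+ n / geosum n.

Lemma lambert_weight1 : lambert_weight 1 = 1 - t.
Proof. by rewrite /lambert_weight /geosum big_ord1 expr0 expr1 invr1 mulr1. Qed.

Lemma lambert_weight_ge0 n : 0 <= lambert_weight n.
Proof.
case: n => [|n].
  by rewrite /lambert_weight /geosum big_ord0 invr0 mulr0 subrr.
have s0 : 0 < geosum n.+1 by rewrite (lt_le_trans _ (geosum_ge1 _)).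
rewrite subr_ge0 ler_pdivrMr// ler_pdivlMl ?ltr0n//.
apply: le_trans (geosum_ge n); rewrite ler_wpM2l// /t -exprM.
by rewrite ler_wiXn2l ?ltW//; lia.
Qed.

(** The difference of consecutive weights is [1 / (n (n + 1)) - t ^ n / (S_n S_(n+1))], where [S] is
    [geosum]; two instances of [geosum_ge] multiply to bound the last denominator from below. *)
Lemma lambert_weight_decr n : (1 <= n)%N ->
  lambert_weight n.+1 <= lambert_weight n.
Proof.
case: n => // n _.
have s0 : 0 < geosum n.+1 by rewrite (lt_le_trans _ (geosum_ge1 _)).
have s1 : 0 < geosum n.+2 by rewrite (lt_le_trans _ (geosum_ge1 _)).
have sE : geosum n.+2 = 1 + t * geosum n.+1.
  rewrite {1}/geosum big_ord_recl expr0 mulr_sumr; congr (_ + _).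
  by apply: eq_bigr => i _; rewrite exprS.
have nn0 : 0 < n.+1%:R * n.+2%:R :> R by rewrite mulr_gt0 ?ltr0n.
rewrite -subr_ge0.
have -> : lambert_weight n.+1 - lambert_weight n.+2 =
    (n.+1%:R * n.+2%:R)^-1 - t ^+ n.+1 / (geosum n.+1 * geosum n.+2).
  rewrite /lambert_weight exprS.
  have -> : n.+2%:R = n.+1%:R + 1 :> R by rewrite natr1.
  move: s1; rewrite sE => s1.
  have n1 : n.+1%:R != 0 :> R by rewrite pnatr_eq0.
  have n2 : n.+1%:R + 1 != 0 :> R by rewrite natr1 pnatr_eq0.
  rewrite [t ^+ n.+2]exprS [t ^+ n.+1]exprS.
  move: (n.+1%:R : R) n1 n2 (geosum n.+1) s0 s1 (t ^+ n) => y y0 y1 s s0 s1 z.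
  by field; rewrite y0 y1 !gt_eqF.
rewrite subr_ge0 ler_pdivrMr ?mulr_gt0// ler_pdivlMl//.
have g0 k : 0 <= k.+1%:R * u ^+ k by rewrite mulr_ge0// exprn_ge0 ?ltW.
apply: le_trans (ler_pM (g0 n) (g0 n.+1) (geosum_ge n) (geosum_ge n.+1)).
rewrite [leRHS]mulrACA ler_wpM2l ?mulr_ge0// /t -exprM -exprD ler_wiXn2l ?ltW//.
by lia.
Qed.

End GeometricSum.

Section RealCharacter.
Variables (R : realType) (m : nat) (chi : nat -> R).
Hypothesis m_gt0 : (0 < m)%N.
Hypothesis chi_bal : balanced m chi.
Hypothesis chi1 : chi 1%N = 1.
Hypothesis chiM : forall a b, chi (a * b)%N = chi a * chi b.
Hypothesis chi_val : forall n, [\/ chi n = 0, chi n = 1 | chi n = -1].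

(** The coefficients of [zeta(s) L(s, chi)]. *)
Definition char_conv n : R := \sum_(d <- divisors n) chi d.

(** The factor [c a] is [1 + chi p + ... + (chi p) ^ a] in Horner form: it is 1, [a + 1] or the
    indicator of even [a], as [chi p] is 0, 1 or -1. *)
Lemma char_conv_pfactor p : prime p -> exists c : nat -> R,
  [/\ forall a, 0 <= c a, forall a, ~~ odd a -> 1 <= c a &
   forall a n, ~~ (p %| n)%N -> (0 < n)%N ->
     char_conv (p ^ a * n) = c a * char_conv n].
Proof.
move=> pp; pose c := fix c a := if a is b.+1 then 1 + chi p * c b else 1 : R.
have cE : forall a n, ~~ (p %| n)%N -> (0 < n)%N ->
    char_conv (p ^ a * n) = c a * char_conv n.
  move=> a n pn n0; elim: a => [|a IH]; first by rewrite expn0 mul1n /= mul1r.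
  rewrite {1}/char_conv sum_divisors_pfactor//= mulrDl mul1r -mulrA -IH.
  by congr (_ + _); rewrite mulr_sumr; apply: eq_bigr => d _; rewrite chiM.
exists c; case: (chi_val p) => chip.
- have c1 a : c a = 1 by case: a => //= a; rewrite chip mul0r addr0.
  by split=> // a; rewrite c1.
- have c1 a : 1 <= c a by elim: a => //= a IH; rewrite chip; lra.
  by split=> // a; rewrite (le_trans _ (c1 a)).
have c1 a : c a = (~~ odd a)%:R.
  by elim: a => //= a ->; rewrite chip; case: odd => /=; rewrite ?mulr0n ?mulr1n; ring.
by split=> // a; rewrite c1// => ->.
Qed.

Lemma char_conv_ge0 n : 0 <= char_conv n.
Proof.
have [->|n0] := posnP n.
  by rewrite /char_conv (_ : divisors 0 = [:: 1%N])// big_seq1 chi1.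
move: n n0; apply: pfactor_ind => [|p a n pp pn n0 IH].
  by rewrite /char_conv (_ : divisors 1 = [:: 1%N])// big_seq1 chi1.
by have [c [c0 _ ->//]] := char_conv_pfactor pp; rewrite mulr_ge0.
Qed.

Lemma char_conv_sqr n : (0 < n)%N -> 1 <= char_conv (n ^ 2).
Proof.
move: n; apply: pfactor_ind => [|p a n pp pn n0 IH].
  by rewrite /char_conv (_ : divisors _ = [:: 1%N])// big_seq1 chi1.
have [c [_ c1 cE]] := char_conv_pfactor pp.
rewrite expnMn -expnM cE ?expn_gt0 ?n0// ?Euclid_dvdX// ?(negbTE pn)//.
by rewrite mulr_ege1// c1// oddM andbF.
Qed.

(** Exchanging sums yields a truncated Lambert series of [chi]. Multiplied by [1 - t], its [d]-th
    term is [chi d] times [1 / d], minus the Lambert weight, minus a truncation error of at most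
    [t ^ N]. The weights decrease from [1 - t], so [abel_bound] controls their sum. *)
Lemma lambert_bound (u : R) N : 0 < u -> u < 1 -> (0 < N)%N ->
  (1 - u ^+ 2) * \sum_(1 <= n < N.+1) char_conv n * (u ^+ 2) ^+ n <=
  `|hsum chi N| + 2 * normsum m chi * (1 - u ^+ 2) + N%:R * (u ^+ 2) ^+ N.
Proof.
move=> u0 u1 N0; set t := u ^+ 2.
have t0 : 0 < t by exact: exprn_gt0.
have t1 : t < 1 by rewrite /t expr_lt1 ?ltW.
have chi_le n : `|chi n| <= 1.
  by case: (chi_val n) => ->; rewrite ?normrN ?normr1 ?normr0.
have -> : (1 - t) * \sum_(1 <= n < N.+1) char_conv n * t ^+ n =
    hsum chi N - \sum_(1 <= d < N.+1) chi d * lambert_weight u d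
    - \sum_(1 <= d < N.+1) chi d * (t ^+ (d * (N %/ d).+1) / geosum u d).
  pose F (d k : nat) : R := chi d * t ^+ (d * k).
  transitivity ((1 - t) * \sum_(1 <= n < N.+1) \sum_(d <- divisors n)
      F d (n %/ d)%N).
    congr (_ * _); apply: eq_big_nat => n /andP[n0 _]; rewrite mulr_suml.
    apply: eq_big_seq => d; rewrite -dvdn_divisors// => dn.
    by rewrite /F mulnC divnK.
  rewrite sum_divisors_hyperbola mulr_sumr /hsum -!sumrB.
  apply: eq_big_nat => d /andP[d0 _].
  have s0 : 0 < geosum u d by rewrite (lt_le_trans _ (geosum_ge1 _ _)).
  rewrite -mulr_sumr mulrCA /lambert_weight -!mulrBr; congr (_ * _).
  rewrite opprB addrCA subrr addr0 -mulrBl.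
  apply: (canRL (mulfK (lt0r_neq0 s0))).
  rewrite mulrAC geosumE.
  elim: (N %/ d)%N => [|K IH]; first by rewrite big_geq// mulr0 muln1 subrr.
  rewrite big_nat_recr//= mulrDr IH -/t.
  by rewrite [in RHS]mulnS exprD; ring.
rewrite (le_trans (ler_norm _))// (le_trans (ler_normB _ _))// lerD//.
  rewrite (le_trans (ler_normB _ _))// lerD2l -(lambert_weight1 u).
  apply: abel_bound => //.
  - by move=> k; exact: balanced_sum_nat.
  - by move=> n; exact: lambert_weight_ge0.
  - by move=> n; exact: lambert_weight_decr.
rewrite (le_trans (ler_norm_sum _ _ _))//.
apply: (@le_trans _ _ (\sum_(1 <= d < N.+1) t ^+ N)); last first.
  by rewrite big_const_nat subn1 /= iter_addr_0 mulr_natl.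
apply: ler_sum_nat => d /andP[d0 _].
have s1 := geosum_ge1 u0 d0; have s0 : 0 < geosum u d by exact: lt_le_trans s1.
rewrite normrM (le_trans (ler_piMl _ (chi_le d)))//.
rewrite ger0_norm; last by rewrite divr_ge0 ?exprn_ge0 ?ltW.
rewrite ler_pdivrMr// (@le_trans _ _ (t ^+ N))//.
  by apply: ler_wiXn2l; rewrite ?ltW// mulnC ltnW// ltn_ceil.
by rewrite ler_peMr// exprn_ge0// ltW.
Qed.

(** All terms are nonnegative, and [char_conv_sqr] bounds from below those at squares, of which the
    first [j] are kept. *)
Lemma sum_char_conv_ge (t : R) j M : 0 < t -> t < 1 -> (j <= M)%N ->
  j%:R * t ^+ (j ^ 2) <= \sum_(1 <= n < (M ^ 2).+1) char_conv n * t ^+ n.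
Proof.
move=> t0 t1 jM.
have term0 n : 0 <= char_conv n * t ^+ n.
  by rewrite mulr_ge0 ?char_conv_ge0 ?exprn_ge0 ?ltW.
apply: (@le_trans _ _ (\sum_(1 <= k < M.+1) t ^+ (k ^ 2))).
  rewrite (big_cat_nat (n := j.+1))//= -[leLHS]addr0 lerD//; last first.
    by rewrite sumr_ge0// => k _; rewrite exprn_ge0 ?ltW.
  have <- : \sum_(1 <= k < j.+1) t ^+ (j ^ 2) = j%:R * t ^+ (j ^ 2).
    by rewrite big_const_nat subn1 /= iter_addr_0 mulr_natl.
  apply: ler_sum_nat => k /andP[_ kj].
  by rewrite ler_wiXn2l ?ltW// leq_exp2r.
elim: M {jM} => [|M IH]; first by rewrite !big_geq.
rewrite big_nat_recr//= [leRHS](big_cat_nat (n := (M ^ 2).+1))//=; last first.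
  by rewrite ltnS leq_exp2r.
rewrite lerD//.
have hM : ((M ^ 2).+1 <= M.+1 ^ 2 < (M.+1 ^ 2).+1)%N.
  by rewrite leqnn andbT ltn_exp2r.
apply: le_trans (ler_sum_nat_term hM _); last by move=> k _; exact: term0.
by rewrite ler_peMl ?char_conv_sqr// exprn_ge0 ?ltW.
Qed.

(* Were [lsum chi] zero, the sums [\sum_n char_conv n * t ^+ n] would stay bounded
   as [t] tends to 1, although they dominate [\sum_k t ^+ (k ^ 2)]. The choice
   [t = (1 - q)^2], [q = 1 / (4 j^2)], [N = q^-3] makes this quantitative. *)
Lemma lsum_char0_bound j : (0 < j)%N -> lsum chi = 0 ->
  j%:R / 2 <= 4 * normsum m chi + 1.
Proof.
move=> j0 L0; have := normsum_ge0 m chi.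
have tail N := lsum_tail m_gt0 N chi_bal.
have lamb u N := @lambert_bound u N.
move: tail lamb; rewrite L0; move: (normsum m chi) => B tail lamb B0.
(* The resulting [N = 64 j ^ 6] is both a square, as [sum_char_conv_ge] requires, and the cube of
   [Q = 1 / q]. *)
have [Q QE] : exists Q, Q = (4 * j ^ 2)%N by eexists.
have [M ME] : exists M, M = (8 * j ^ 3)%N by eexists.
have [N NE] : exists N, N = (M ^ 2)%N by eexists.
have NQ : N = (Q ^ 3)%N by rewrite NE ME QE; ring.
have jM : (j <= M)%N by rewrite ME expnS mulnCA leq_pmulr// muln_gt0 expn_gt0 j0.
have Q4 : (4 <= Q)%N by rewrite QE leq_pmulr// expn_gt0 j0.
have QN : (Q <= N.+1)%N by rewrite NQ leqW// expnS leq_pmulr// expn_gt0 (ltnW (ltnW (ltnW Q4))).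
have N0 : (0 < N)%N by rewrite NQ expn_gt0 (ltnW (ltnW (ltnW Q4))).
have Q4' : 4 <= Q%:R :> R by rewrite ler_nat.
have Q0 : 0 < Q%:R :> R by lra.
have [q qE] : exists q : R, q = Q%:R^-1 by eexists.
have q0 : 0 < q by rewrite qE invr_gt0.
have Qq : Q%:R * q = 1 by rewrite qE divff// gt_eqF.
have q1 : q <= 1 / 4 by have := ler_wpM2r (ltW q0) Q4'; rewrite Qq; lra.
have jq : (2 * j ^ 2)%:R * q = 2^-1 :> R.
  have QE' : Q = (2 * (2 * j ^ 2))%N by rewrite QE mulnA.
  by move: Qq; rewrite QE' natrM; lra.
have Nq : N%:R * q ^+ 3 = 1 by rewrite NQ natrX -exprMn Qq expr1n.
have Nq' : N.+1%:R^-1 <= q.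
  by rewrite qE lef_pV2 ?posrE ?Q0 ?ltr0n// ler_nat.
have N0' : 0 < N%:R :> R by rewrite ltr0n.
have [u uE] : exists u : R, u = 1 - q by eexists.
have u0 : 0 < u by lra.
have u1 : u < 1 by lra.
have [t tE] : exists t : R, t = u ^+ 2 by eexists.
have t0 : 0 < t by rewrite tE exprn_gt0.
have t1 : t < 1 by rewrite tE expr_lt1 ?ltW.
have tq : q <= 1 - t.
  by rewrite tE uE expr2; have := mulr_ge0 (ltW q0) (ltW u0); rewrite uE; lra.
(* By Bernoulli, [(1 - q) ^ (2 j ^ 2) >= 1 - 2 j ^ 2 q = 1 / 2]. *)
have low : j%:R / 2 <= \sum_(1 <= n < N.+1) char_conv n * t ^+ n.
  rewrite NE; apply: le_trans (sum_char_conv_ge t0 t1 jM).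
  rewrite ler_wpM2l// tE -exprM uE.
  have : -1 <= - q by lra.
  move=> /(bernoulli_le (2 * j ^ 2)); rewrite mulrN jq; apply: le_trans; lra.
(* Here [u (1 + q) = 1 - q ^ 2 <= 1], while [(1 + q) ^ N >= N q]. *)
have uN : u ^+ N * (N%:R * q) <= 1.
  have uq : 0 <= u * (1 + q) <= 1.
    apply/andP; split; first by rewrite mulr_ge0// ?ltW//; lra.
    by rewrite uE; have := sqr_ge0 q; rewrite expr2; lra.
  have : (u * (1 + q)) ^+ N <= 1 by rewrite exprn_ile1//; case/andP: uq.
  have : 1 + N%:R * q <= (1 + q) ^+ N by rewrite bernoulli_le//; lra.
  rewrite exprMn => h; apply: le_trans; rewrite ler_wpM2l ?exprn_ge0 ?ltW//.
  by move: h; lra.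
(* Squaring the previous bound and using [N q ^ 3 = 1] gives [N t ^ N <= q]. *)
have tN : N%:R * t ^+ N <= 1 - t.
  apply: le_trans tq.
  rewrite -(ler_pM2l (_ : 0 < N%:R * q ^+ 2)) ?mulr_gt0 ?exprn_gt0//.
  have -> : N%:R * q ^+ 2 * q = N%:R * q ^+ 3 by rewrite -mulrA -exprSr.
  rewrite Nq.
  have -> : N%:R * q ^+ 2 * (N%:R * t ^+ N) = (u ^+ N * (N%:R * q)) ^+ 2.
    by rewrite tE -exprM mulnC exprM; ring.
  by rewrite expr_le1// mulr_ge0 ?exprn_ge0 ?mulr_ge0 ?ltW.
have H : `|hsum chi N| <= 2 * B * (1 - t).
  have := tail N; rewrite sub0r normrN => /le_trans; apply.
  by rewrite ler_wpM2l ?mulr_ge0// (le_trans Nq').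
have := lamb u N u0 u1 N0; rewrite -tE => h.
apply: le_trans low _; rewrite -(ler_pM2l (_ : 0 < 1 - t)) ?subr_gt0//.
by apply: le_trans h _; lra.
Qed.

Lemma lsum_char_neq0 : lsum chi != 0.
Proof.
apply/negP => /eqP L0; have B0 := normsum_ge0 m chi.
have [j [j0 Bj]] : exists j : nat, (0 < j)%N /\ 8 * normsum m chi + 4 < j%:R.
  exists (Num.bound (8 * normsum m chi + 4)).+1; split=> //.
  by rewrite (lt_trans (archi_boundP _)) ?ltr_nat ?ltnSn// addr_ge0 ?mulr_ge0.
by have := lsum_char0_bound j0 L0; lra.
Qed.

End RealCharacter.

(** * Primes in residue classes *)

Section PrimeDensity.
Variables (R : realType) (m : nat).
Hypothesis m_gt1 : (1 < m)%N.
Local Notation mangoldt := (mangoldt R).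
Let m_gt0 : (0 < m)%N. Proof. exact: ltnW. Qed.
Implicit Types f : nat -> R.

Definition cop (n : nat) : R := (coprime n m)%:R.

Lemma cop_periodic n : cop (n + m) = cop n.
Proof. by rewrite /cop -coprime_modl modnDr coprime_modl. Qed.

Lemma sum_cop_gt0 : 0 < \sum_(i < m) cop i.
Proof.
rewrite (bigD1 (Ordinal m_gt1))//= ltr_pwDl ?sumr_ge0//.
by rewrite /cop coprime1n.
Qed.

Lemma dilate_dilate d e f : dilate d (dilate e f) = dilate (e * d) f.
Proof. by apply/funext => n; rewrite /dilate mulnA. Qed.

Lemma dilate_noncoprime d f : balanced m f -> ~~ coprime d m ->
  dilate d f = fun=> 0.
Proof.
move=> [_ fc _] dm; apply/funext => n; rewrite /dilate fc//.
by rewrite coprimeMl negb_and dm.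
Qed.

Lemma balanced0 : balanced m (fun=> 0 : R).
Proof. by split=> //; rewrite big1. Qed.

Lemma lsum0 : lsum (fun=> 0 : R) = 0.
Proof.
apply: (@lsum_unique _ _ m_gt0 _ _ 0) => [|N]; first exact: balanced0.
by rewrite /hsum big1 ?subrr ?normr0 ?mul0r// => n _; rewrite mul0r.
Qed.

Lemma lsum_norm_le f : balanced m f -> `|lsum f| <= 2 * normsum m f.
Proof.
by move=> bf; have := lsum_tail m_gt0 0 bf; rewrite /hsum big_geq// subr0 divr1.
Qed.

Lemma ln_mul_bounded (x C : R) :
  (forall N, (0 < N)%N -> x * ln N%:R <= C) -> x <= 0.
Proof.
move=> h; rewrite leNgt; apply/negP => x0.
have [N NC] : exists N, C / x < ln N%:R /\ (0 < N)%N.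
  pose N := Num.bound (expR (C / x)).
  have eN : expR (C / x) < N%:R by rewrite (archi_boundP (expR_ge0 _)).
  have N0 : 0 < N%:R :> R by rewrite (lt_trans (expR_gt0 _) eN).
  exists N; split; last by rewrite -(ltr0n R).
  by rewrite -ltr_expR lnK.
have [NC1 N0] := NC; have := h _ N0; rewrite leNgt mulrC.
by rewrite -ltr_pdivrMr// NC1.
Qed.

(* [autocor] also lies in the kernel of [f |-> (h |-> lsum (dilate h f))], and its
   values are at least [- autocor 1], with equality exactly on [flip]. *)
Section Kernel.
Variable f : nat -> R.
Hypothesis f_bal : balanced m f.
Hypothesis f_ker : forall d, lsum (dilate d f) = 0.

Let autocor (n : nat) : R := \sum_(g < m) f g * dilate g f n.

Let autocor_bal : balanced m autocor.
Proof. by apply: balanced_sum => g; exact: balanced_dilate. Qed.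

Let autocor_ker d : lsum (dilate d autocor) = 0.
Proof.
have -> : dilate d autocor =
    fun n => \sum_(g < m) f g * dilate (g * d) f n.
  apply/funext => n; rewrite /dilate /autocor; apply: eq_bigr => g _.
  by rewrite /dilate mulnA.
rewrite (lsum_sum m_gt0); last by move=> g; exact: balanced_dilate.
by rewrite big1// => g _; rewrite f_ker mulr0.
Qed.

Let flip n := coprime n m && `[< forall g, f (g * n)%N = - f g >].
Let nonflip n := coprime n m && ~~ flip n.

Let f_mod n : f n = f (n %% m)%N.
Proof. by apply: periodic_mod; case: f_bal. Qed.

Let gap n : R := autocor n + autocor 1 * cop n.

(** Multiplication by [n] permutes the residues, so both kinds of squares in the expansion sum to
    [autocor 1]. *)
Let gap_sqr n : coprime n m ->
  gap n = 2^-1 * \sum_(g < m) (f g + f (g * n)%N) ^+ 2.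
Proof.
move=> nm; rewrite /gap /autocor /cop nm mulr1 /dilate.
under [X in _ + X = _]eq_bigr do rewrite muln1.
have e : \sum_(g < m) f (g * n)%N ^+ 2 = \sum_(g < m) f g * f g.
  rewrite -(@sum_dilate _ m m_gt0 (fun k => f k * f k) n)//.
    by apply: eq_bigr => g _; rewrite /dilate mulnC expr2.
  by move=> k; have [-> _ _] := f_bal.
have -> : \sum_(g < m) (f g + f (g * n)%N) ^+ 2 =
   2 * \sum_(g < m) f g * f (g * n)%N + \sum_(g < m) f g * f g +
   \sum_(g < m) f (g * n)%N ^+ 2.
  rewrite mulr_sumr -!big_split /=; apply: eq_bigr => g _.
  by rewrite !expr2; ring.
by rewrite e; field.
Qed.

Let gap_ge0 n : 0 <= gap n.
Proof.
have [nm|nm] := boolP (coprime n m).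
  rewrite gap_sqr//; apply: mulr_ge0; first by rewrite invr_ge0.
  by apply: sumr_ge0 => g _; exact: sqr_ge0.
by rewrite /gap /cop (negbTE nm) mulr0 addr0; case: autocor_bal => _ ->.
Qed.

Let gap_gt0 n : nonflip n -> 0 < gap n.
Proof.
move=> /andP[nm]; rewrite /flip nm /= => /asboolPn/existsNP[g fg].
rewrite gap_sqr//; apply: mulr_gt0; first by rewrite invr_gt0.
rewrite (bigD1 (Ordinal (ltn_pmod g m_gt0)))//=; apply: ltr_pwDl.
  rewrite lt_neqAle sqr_ge0 andbT eq_sym expf_eq0 /= addr_eq0.
  apply/negP => /eqP e; apply: fg; rewrite f_mod -modnMml -f_mod.
  by rewrite (f_mod g) e opprK.
by apply: sumr_ge0 => i _; exact: sqr_ge0.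
Qed.

(** The main terms of [autocor] and [autocor 1 * cop] cancel, so the sum of [gap] weighted by
    [mangoldt n / n] is bounded. As [gap] takes finitely many values, those on [nonflip] are bounded
    away from 0. *)
Let nonflip_light : exists C, forall N,
  \sum_(1 <= n < N.+1) mangoldt n / n%:R * (nonflip n)%:R <= C.
Proof.
have [C1 h1] := sum_mangoldt_lsum0 m_gt0 autocor_bal autocor_ker.
have [C2 h2] := mertens_coprime R m_gt0.
pose K := \sum_(i < m) (gap i)^-1.
have K0 : 0 <= K by rewrite sumr_ge0// => i _; rewrite invr_ge0.
exists (K * (C1 + autocor 1 * C2)) => N.
have a0 : 0 <= autocor 1.
  by rewrite /autocor sumr_ge0// => g _; rewrite /dilate muln1 -expr2 sqr_ge0.
have [->|N0] := posnP N.
  rewrite big_geq// mulr_ge0// addr_ge0 ?mulr_ge0//.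
    by rewrite (le_trans (normr_ge0 _) (h1 1%N isT)).
  by rewrite (le_trans (normr_ge0 _) (h2 1%N isT)).
apply: (@le_trans _ _ (K * \sum_(1 <= n < N.+1) mangoldt n / n%:R * gap n)).
  rewrite mulr_sumr; apply: ler_sum_nat => n _.
  rewrite mulrCA ler_wpM2l ?divr_ge0 ?mangoldt_ge0//.
  case: (boolP (nonflip n)) => [nf|_]; last by rewrite mulr_ge0.
  have gn := gap_gt0 nf.
  have gapE : gap n = gap (n %% m)%N.
    apply: periodic_mod => k; rewrite /gap cop_periodic.
    by have [-> _ _] := autocor_bal.
  rewrite -(mulVf (lt0r_neq0 gn)); apply: ler_wpM2r; first exact: ltW.
  rewrite /K (bigD1 (Ordinal (ltn_pmod n m_gt0)))//= -gapE lerDl sumr_ge0// => i _.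
  by rewrite invr_ge0.
rewrite ler_wpM2l//.
have -> : \sum_(1 <= n < N.+1) mangoldt n / n%:R * gap n =
  (\sum_(1 <= n < N.+1) mangoldt n / n%:R * autocor n + autocor 1 * ln N%:R) +
  autocor 1 * (\sum_(1 <= n < N.+1) mangoldt n / n%:R * cop n - ln N%:R).
  rewrite mulrBr addrACA subrr addr0 mulr_sumr -big_split.
  by apply: eq_bigr => n _; rewrite /gap /=; ring.
apply: lerD; first exact: le_trans (ler_norm _) (h1 _ N0).
by rewrite ler_wpM2l// (le_trans (ler_norm _) (h2 _ N0)).
Qed.

Let flip_heavy : exists C, forall N, (0 < N)%N ->
  `|\sum_(1 <= n < N.+1) mangoldt n / n%:R * (flip n)%:R - ln N%:R| <= C.
Proof.
have [C1 h1] := nonflip_light; have [C2 h2] := mertens_coprime R m_gt0.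
exists (C2 + C1) => N N0.
have -> : \sum_(1 <= n < N.+1) mangoldt n / n%:R * (flip n)%:R =
  \sum_(1 <= n < N.+1) mangoldt n / n%:R * (coprime n m)%:R -
  \sum_(1 <= n < N.+1) mangoldt n / n%:R * (nonflip n)%:R.
  rewrite -sumrB; apply: eq_bigr => n _; rewrite -mulrBr; congr (_ * _).
  rewrite /nonflip /flip; case: coprime => /=; last by rewrite subrr.
  by case: asbool; rewrite ?subr0 ?subrr.
rewrite addrAC (le_trans (ler_normB _ _))// lerD ?h2// ger0_norm//.
by rewrite sumr_ge0// => n _; rewrite mulr_ge0// divr_ge0 ?mangoldt_ge0.
Qed.

(** Up to a bounded total weight, the prime powers coprime to [m] lie in [flip], so only the value
    of [phi] there reaches the main term. *)
Let flip_mean (phi : nat -> R) (c B : R) :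
  (forall n, flip n -> phi n = c) -> (forall n, `|phi n| <= B) ->
  (forall n, ~~ coprime n m -> phi n = 0) ->
  exists C, forall N, (0 < N)%N ->
    `|\sum_(1 <= n < N.+1) mangoldt n / n%:R * phi n - c * ln N%:R| <= C.
Proof.
move=> phic phiB phi0.
have [C1 h1] := nonflip_light; have [C2 h2] := flip_heavy.
have B0 : 0 <= B := le_trans (normr_ge0 _) (phiB 0%N).
exists (`|c| * C2 + B * C1) => N N0.
have -> : \sum_(1 <= n < N.+1) mangoldt n / n%:R * phi n =
  c * \sum_(1 <= n < N.+1) mangoldt n / n%:R * (flip n)%:R +
  \sum_(1 <= n < N.+1) mangoldt n / n%:R * (nonflip n)%:R * phi n.
  rewrite mulr_sumr -big_split; apply: eq_bigr => n _ /=.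
  rewrite /nonflip; have [fn|fn] := boolP (flip n).
    by rewrite (phic _ fn) andbF !(mulr0, mulr1, mul0r, addr0) mulrC.
  rewrite andbT mulr0 mulr0 add0r.
  have [cn|cn] := boolP (coprime n m); first by rewrite mulr1.
  by rewrite phi0// !mulr0.
rewrite addrAC -mulrBr (le_trans (ler_normD _ _))// lerD//.
  by rewrite normrM ler_wpM2l// h2.
rewrite (le_trans (ler_norm_sum _ _ _))//.
apply: le_trans (ler_wpM2l B0 (h1 N)); rewrite mulr_sumr.
apply: ler_sum_nat => n _.
have x0 : 0 <= mangoldt n / n%:R * (nonflip n)%:R.
  by rewrite mulr_ge0// divr_ge0 ?mangoldt_ge0.
by rewrite normrM mulrC (ger0_norm x0) ler_wpM2r.
Qed.

Let inK n := coprime n m &&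
  `[< (forall g, f (g * n)%N = f g) \/ (forall g, f (g * n)%N = - f g) >].

Let inK_flip d n : flip d -> inK (d * n)%N = inK n.
Proof.
move=> /andP[dm /asboolP fd]; rewrite /inK coprimeMl dm /=; congr (_ && _).
have e g : f (g * (d * n))%N = - f (g * n)%N by rewrite mulnCA mulnC fd.
apply: asbool_equiv_eq; split=> -[] h; [right|left|right|left] => g;
  rewrite ?e ?h ?opprK//.
- by rewrite -[LHS]opprK -e h.
- by rewrite -[LHS]opprK -e h opprK.
Qed.

Let kap : R := (\sum_(i < m) (inK i)%:R) / \sum_(i < m) cop i.
Let w n : R := (inK n)%:R - kap * cop n.

Let w_bal : balanced m w.
Proof.
split=> [n|n nm|].
- rewrite /w cop_periodic; congr (_%:R - _); congr nat_of_bool.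
  rewrite /inK -coprime_modl modnDr coprime_modl; congr (_ && _).
  suff e g : f (g * (n + m))%N = f (g * n)%N.
    by apply: asbool_equiv_eq; split=> -[] h; [left|right|left|right] => g;
      rewrite ?e ?h -?e ?h.
  by rewrite f_mod mulnDr addnC modnMDl -f_mod.
- by rewrite /w /inK /cop (negbTE nm) mulr0 subrr.
- by rewrite sumrB -mulr_sumr divfK ?subrr// lt0r_neq0 ?sum_cop_gt0.
Qed.

Let w_flip d h : flip d -> dilate (h * d) w = dilate h w.
Proof.
move=> fd; apply/funext => n; rewrite /dilate /w mulnAC mulnC inK_flip//.
by rewrite /cop coprimeMl; case/andP: fd => ->.
Qed.

(** The values [lsum (dilate (h * d) w)] are constant for [d] in [flip], so by [flip_mean] their sum
    against [mangoldt d / d] is [lsum (dilate h w) * ln N + O(1)]; by [sum_mangoldt_lsum] it is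
    bounded. *)
Let w_ker h : lsum (dilate h w) = 0.
Proof.
have bw := balanced_dilate m_gt0 h w_bal.
have [C1 h1] := sum_mangoldt_lsum m_gt0 bw.
pose phi d := lsum (dilate d (dilate h w)).
have [|||C2 h2] := @flip_mean phi (lsum (dilate h w)) (2 * normsum m w).
- by move=> d fd; rewrite /phi dilate_dilate w_flip.
- move=> d; rewrite /phi dilate_dilate.
  have bd := balanced_dilate m_gt0 (h * d) w_bal.
  rewrite (le_trans (lsum_norm_le bd))// ler_wpM2l//.
  exact: normsum_dilate.
- by move=> d dm; rewrite /phi dilate_noncoprime// lsum0.
apply/eqP; rewrite -normr_le0; apply: (@ln_mul_bounded _ (C1 + C2)) => N N0.
have := h1 N; have := h2 N N0; rewrite -/phi.
set S := \sum_(_ <= _ < _) _ => a b.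
have -> : `|lsum (dilate h w)| * ln N%:R = `|lsum (dilate h w) * ln N%:R|.
  by rewrite normrM [X in _ = _ * X]ger0_norm// ln_nat_ge0.
rewrite -(subrK S (_ * _)) (le_trans (ler_normD _ _))// addrC lerD//.
by rewrite distrC.
Qed.

(* [w] is the mean-zero projection of the indicator of the subgroup [inK], which
   contains [flip]; if [inK] were a proper subgroup, [w] would be in the kernel
   while its mean over primes is [+ w 1] instead of [- w 1]. *)
Let flip_sign n : coprime n m ->
  (forall g, f (g * n)%N = f g) \/ (forall g, f (g * n)%N = - f g).
Proof.
move=> nm; have [C1 h1] := sum_mangoldt_lsum0 m_gt0 w_bal w_ker.
have [|||C2 h2] := @flip_mean w (w 1) (1 + `|kap|).
- by move=> d fd; have := congr1 (fun F => F 1%N) (w_flip 1 fd);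
    rewrite /dilate mul1n !muln1.
- move=> d; rewrite (le_trans (ler_normB _ _))// lerD//.
    by rewrite ger0_norm// lern1 leq_b1.
  by rewrite normrM ler_piMr// ger0_norm /cop// lern1 leq_b1.
- by case: w_bal.
have w1 : w 1 = 0.
  apply/eqP; rewrite -normr_le0 -(pmulr_rle0 _ (ltr0Sn R 1)).
  apply: (@ln_mul_bounded _ (C1 + C2)) => N N0.
  have := h1 N N0; have := h2 N N0.
  set S := \sum_(_ <= _ < _) _ => a b.
  have -> : 2 * `|w 1| * ln N%:R = `|2 * w 1 * ln N%:R|.
    by rewrite !normrM [`|2|]ger0_norm// [`|ln _|]ger0_norm// ln_nat_ge0.
  have -> : 2 * w 1 * ln N%:R =
    (S + w 1 * ln N%:R) - (S - w 1 * ln N%:R) by ring.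
  by rewrite (le_trans (ler_normB _ _))// lerD.
have kap1 : kap = 1.
  have i1 : inK 1%N.
    by rewrite /inK coprime1n; apply/asboolP; left => g; rewrite muln1.
  by move: w1; rewrite /w i1 /cop coprime1n mulr1 => /eqP; rewrite subr_eq0 => /eqP.
have s0 : \sum_(i < m) (cop i - (inK i)%:R) = 0.
  have e : kap * \sum_(i < m) cop i = \sum_(i < m) (inK i)%:R.
    by rewrite /kap divfK// lt0r_neq0// sum_cop_gt0.
  by move: e; rewrite sumrB kap1 mul1r => ->; rewrite subrr.
have pos i : 0 <= cop i - (inK i)%:R.
  by rewrite subr_ge0 /cop /inK ler_nat; case: coprime => //=; exact: leq_b1.
have : inK (n %% m)%N.
  have := s0 => /eqP; rewrite psumr_eq0// => /allP.
  move=> /(_ (Ordinal (ltn_pmod n m_gt0)))/=.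
  rewrite mem_index_enum => /(_ isT); rewrite /cop coprime_modl nm.
  by case: inK => //; rewrite subr0 oner_eq0.
move=> /andP[_ /asboolP].
have e g : f (g * (n %% m))%N = f (g * n)%N.
  by rewrite f_mod modnMmr -f_mod.
by case=> h; [left|right] => g; rewrite -e h.
Qed.

(** By [flip_sign], either [f 1 = 0] and [f] vanishes on all reduced residues, or [f / f 1] is a
    real character with zero [lsum], against [lsum_char_neq0]. *)
Lemma lsum_kernel n : f n = 0.
Proof.
have fc := let: And3 _ fc _ := f_bal in fc.
have [f1|f1] := eqVneq (f 1%N) 0.
  have [nm|/fc//] := boolP (coprime n m).
  by rewrite -[n]mul1n; case: (flip_sign nm) => ->; rewrite f1 ?oppr0.
pose chi k := (f 1%N)^-1 * f k.
have chi_bal : balanced m chi.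
  have [fm _ fs] := f_bal; split=> [k|k km|].
  - by rewrite /chi fm.
  - by rewrite /chi (fc k) ?mulr0.
  - by rewrite -mulr_sumr fs mulr0.
have chi1 : chi 1%N = 1 by rewrite /chi mulVf.
have chi_sign b : coprime b m -> (forall a, chi (a * b)%N = chi a) /\ chi b = 1
    \/ (forall a, chi (a * b)%N = - chi a) /\ chi b = -1.
  move=> bm; case: (flip_sign bm) => h; [left|right]; split=> [a|].
  - by rewrite /chi h.
  - by rewrite /chi -[b]mul1n h mulVf.
  - by rewrite /chi h mulrN.
  - by rewrite /chi -[b]mul1n h mulrN mulVf.
have chi0 b : ~~ coprime b m -> chi b = 0 by move=> bm; rewrite /chi (fc b) ?mulr0.
have chiM a b : chi (a * b)%N = chi a * chi b.
  have [bm|bm] := boolP (coprime b m).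
    by case: (chi_sign b bm) => -[-> ->]; rewrite ?mulrN mulr1.
  by rewrite (chi0 b)// mulr0 chi0// coprimeMl negb_and bm orbT.
have chi_val k : [\/ chi k = 0, chi k = 1 | chi k = -1].
  have [km|km] := boolP (coprime k m); last by constructor 1; exact: chi0.
  by case: (chi_sign k km) => -[_ ->]; [constructor 2|constructor 3].
have := lsum_char_neq0 m_gt0 chi_bal chi1 chiM chi_val.
have -> : lsum chi = 0; last by rewrite eqxx.
have -> : chi = fun k => \sum_(i < 1) (f 1%N)^-1 * f k.
  by apply/funext => k; rewrite big_ord1.
rewrite (lsum_sum m_gt0 (fun=> (f 1%N)^-1))// big_ord1.
have -> : f = dilate 1 f by apply/funext => k; rewrite /dilate mul1n.
by rewrite f_ker mulr0.
Qed.

End Kernel.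

(** By [lsum_kernel] the map [f |-> (h |-> lsum (dilate h f))] is injective on balanced functions,
    hence onto by finite dimension; [sum_mangoldt_lsum] applies to a preimage of [t]. *)
Lemma sum_mangoldt_balanced t : balanced m t -> exists C, forall N,
  `|\sum_(1 <= n < N.+1) mangoldt n / n%:R * t n| <= C.
Proof.
move=> t_bal; pose U : R := \sum_(i < m) cop i.
have U0 : U != 0 by rewrite lt0r_neq0 ?sum_cop_gt0.
pose o n : 'I_m := Ordinal (ltn_pmod n m_gt0).
have oE (j : 'I_m) : o j = j by apply: val_inj; rewrite /= modn_small.
(* The mean-zero projection of the indicator of class [i]; thus [f0 v] below is [v - mean v] on the
   reduced residues. *)
pose beta (i : 'I_m) n : R := cop n * ((o n == i)%:R - cop i / U).
have beta_bal i : balanced m (beta i).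
  split=> [n|n nm|].
  - rewrite /beta cop_periodic (_ : o (n + m)%N = o n)//.
    by apply: val_inj; rewrite /= modnDr.
  - by rewrite /beta /cop (negbTE nm) mul0r.
  - rewrite /beta; under eq_bigr do rewrite mulrBr oE.
    rewrite sumrB -mulr_suml mulrCA divff// mulr1 (bigD1 i)//= eqxx mulr1.
    by rewrite big1 ?addr0 ?subrr// => j /negbTE ->; rewrite mulr0.
(* To obtain an invertible square matrix, the mean removed by the projection is added back on
   reduced residues, and the other coordinates are left fixed. *)
pose M : 'M[R]_m := \matrix_(i, j)
  if coprime j m then lsum (dilate j (beta i)) + cop i / U else (i == j)%:R.
pose f0 (v : 'rV[R]_m) n : R := \sum_i v 0 i * beta i n.
have f0_bal v : balanced m (f0 v) by exact: balanced_sum.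
pose mean (v : 'rV[R]_m) : R := \sum_i v 0 i * (cop i / U).
have ME v (j : 'I_m) : coprime j m ->
    (v *m M) 0 j = lsum (dilate j (f0 v)) + mean v.
  move=> jm; rewrite mxE (_ : dilate j (f0 v) =
    fun n => \sum_i v 0 i * dilate j (beta i) n)//.
  rewrite (lsum_sum m_gt0); last by move=> i; exact: balanced_dilate.
  by rewrite -big_split; apply: eq_bigr => i _; rewrite mxE jm mulrDr.
have ME0 v (j : 'I_m) : ~~ coprime j m -> (v *m M) 0 j = v 0 j.
  move=> /negbTE jm; rewrite mxE (bigD1 j)//= mxE jm eqxx mulr1.
  by rewrite big1 ?addr0// => i /negbTE ij; rewrite mxE jm ij mulr0.
have sumL v : \sum_(j < m) lsum (dilate j (f0 v)) = 0.
  transitivity (\sum_(j < m) 1 * lsum (dilate j (f0 v))).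
    by apply: eq_bigr => j _; rewrite mul1r.
  rewrite -(lsum_sum m_gt0 (fun=> 1)); last by move=> j; exact: balanced_dilate.
  rewrite -[RHS]lsum0; congr lsum; apply/funext => n.
  have [_ _ bn] := balanced_dilate m_gt0 n (f0_bal v).
  rewrite -[RHS]bn.
  by apply: eq_bigr => j _; rewrite mul1r /dilate mulnC.
have lnc v (j : nat) : ~~ coprime j m -> lsum (dilate j (f0 v)) = 0.
  by move=> jm; rewrite dilate_noncoprime// lsum0.
(* Summed over the reduced residues, the [lsum] terms cancel by [sumL], so a balanced image forces a
   zero mean. *)
have meanE v t' : balanced m t' ->
    (forall j : 'I_m, (v *m M) 0 j = t' j) -> mean v = 0.
  move=> [_ tc ts] vt; apply: (mulfI U0); rewrite mulr0.
  transitivity (\sum_(j < m) t' j - \sum_(j < m) lsum (dilate j (f0 v))).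
    rewrite -sumrB mulr_suml; apply: eq_bigr => j _.
    have [jm|jm] := boolP (coprime j m).
      by rewrite -vt ME// /cop jm mul1r addrAC subrr add0r.
    by rewrite tc// lnc// /cop (negbTE jm) mul0r subrr.
  by rewrite ts sumL subrr.
have lmod v n : lsum (dilate n (f0 v)) = lsum (dilate (o n) (f0 v)).
  congr lsum; apply/funext => k; rewrite /dilate.
  have [fm _ _] := f0_bal v.
  by rewrite (periodic_mod (m := m))// -modnMml -(periodic_mod (m := m)).
have Mfree : M \in unitmx.
  rewrite -row_free_unit -kermx_eq0; apply/eqP/row_matrixP => i; rewrite row0.
  have : row i (kermx M) *m M = 0 by rewrite -row_mul mulmx_ker row0.
  move: (row i _) => v vM.
  have mv : mean v = 0.
    by apply: (meanE _ _ balanced0) => j; rewrite vM mxE.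
  have f00 : forall n, f0 v n = 0.
    apply: lsum_kernel => // d; rewrite lmod.
    have [jm|jm] := boolP (coprime (o d) m); last exact: lnc.
    by have := ME v _ jm; rewrite vM mxE mv addr0.
  apply/rowP => j; rewrite mxE.
  have [jm|jm] := boolP (coprime j m); last by rewrite -ME0// vM mxE.
  have := f00 j; rewrite /f0 /beta oE; under eq_bigr do rewrite mulrCA mulrBr.
  rewrite -mulr_sumr /cop jm mul1r sumrB -/(cop _) -/(mean v) mv subr0.
  rewrite (bigD1 j)//= eqxx mulr1 big1 ?addr0// => i' ij.
  by rewrite eq_sym (negbTE ij) mulr0.
pose v := (\row_(j < m) t j) *m invmx M.
have vt (j : 'I_m) : (v *m M) 0 j = t j by rewrite /v mulmxKV// mxE.
have mv := meanE _ _ t_bal vt.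
have tE n : t n = lsum (dilate n (f0 v)).
  have [tm tc _] := t_bal; rewrite lmod (periodic_mod (m := m))// -[(n %% m)%N]/(val (o n)).
  have [jm|jm] := boolP (coprime (o n) m); last by rewrite lnc// tc.
  by rewrite -vt ME// mv addr0.
have [C hC] := sum_mangoldt_lsum m_gt0 (f0_bal v).
by exists C => N; have := hC N; under eq_bigr do rewrite -tE.
Qed.

End PrimeDensity.

(** * Pade approximation of the factorial series *)

Section Pade.
Variable xi : int.
Implicit Types x y d : int.

(* The recurrence of the Pade approximants: the initial values [(1, xi - 1)] give
   the denominators [B_n], and [(0, -1)] the numerators [A_n], so that
   [pade F ((xi - 1) * F + 1) n = B_n * F - A_n]. *)
Fixpoint pade x y (n : nat) : int :=
  match n with
  | 0 => x
  | k.+1 => match k with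
    | 0 => y
    | j.+1 => ((2 * k + 1)%:Z * xi - 1) * pade x y k -
              k%:Z ^+ 2 * xi ^+ 2 * pade x y j
    end
  end.

Lemma padeSS x y n : pade x y n.+2 =
  ((2 * n.+1 + 1)%:Z * xi - 1) * pade x y n.+1 -
  n.+1%:Z ^+ 2 * xi ^+ 2 * pade x y n.
Proof. by []. Qed.

Lemma nat_ind2 (P : nat -> Prop) : P 0%N -> P 1%N ->
  (forall n, P n -> P n.+1 -> P n.+2) -> forall n, P n.
Proof.
move=> P0 P1 PS n; suff [] : P n /\ P n.+1 by [].
by elim: n => // n [Pn Pn1]; split=> //; exact: PS.
Qed.

Lemma pade_linear c x y x' y' n :
  pade (c * x - x') (c * y - y') n = c * pade x y n - pade x' y' n.
Proof.
elim/nat_ind2: n => // n IH1 IH2; rewrite !padeSS IH1 IH2; ring.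
Qed.

Lemma pade_dvd d x y n : (d %| x)%Z -> (d %| y)%Z -> (d %| pade x y n)%Z.
Proof.
move=> dx dy; elim/nat_ind2: n => // n IH1 IH2; rewrite padeSS.
by rewrite rpredB// dvdz_mull.
Qed.

(** For [xi != 0] the recurrence runs backwards, so two consecutive zeros would propagate down to
    the initial values. *)
Lemma pade_neq0 x y n : xi != 0 -> (x != 0) || (y != 0) ->
  (pade x y n != 0) || (pade x y n.+1 != 0).
Proof.
move=> xi0; apply: contraTT; rewrite !negb_or !negbK.
elim: n => [|n IH]//; rewrite padeSS => /andP[/eqP e].
have c0 : n.+1%:Z ^+ 2 * xi ^+ 2 != 0 by rewrite mulf_neq0 ?expf_neq0.
rewrite e mulr0 sub0r oppr_eq0 mulf_eq0 (negbTE c0) /= => p0.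
by apply: IH; rewrite e p0 eqxx.
Qed.

(** The constant 3 works because [3 ^ 2 >= 2 * 3 + 1]: the two terms of the recurrence contribute 6
    and at most 1 against 9. *)
Lemma pade_bound x y (M : int) n : xi != 0 -> `|x| <= M -> `|y| <= M ->
  `|pade x y n| <= M * (3 * `|xi|) ^+ n * n`!%:Z.
Proof.
move=> xi0 xM yM; have M0 : 0 <= M := le_trans (normr_ge0 x) xM.
have xi1 : 1 <= `|xi| by rewrite -gtz0_ge1 normr_gt0.
elim/nat_ind2: n => [||n IH1 IH2].
- by rewrite expr0 !mulr1.
- rewrite expr1 (_ : 1`! = 1%N)// mulr1 (le_trans yM)// ler_peMr//; lia.
rewrite padeSS (le_trans (ler_normB _ _))//.
rewrite [`|_ * pade x y n.+1|]normrM [`|_ * pade x y n|]normrM.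
set c := 3 * `|xi| in IH1 IH2 *.
have h1 : `|(2 * n.+1 + 1)%:Z * xi - 1| <= (2 * n.+2)%:Z * `|xi|.
  rewrite (le_trans (ler_normB _ _))// normrM normr1 ger0_norm//; lia.
have c0 : 0 <= c by rewrite mulr_ge0.
have A0 : 0 <= M * c ^+ n * n`!%:Z by rewrite !mulr_ge0 ?exprn_ge0.
have -> : `|n.+1%:Z ^+ 2 * xi ^+ 2| = n.+1%:Z ^+ 2 * `|xi| ^+ 2.
  by rewrite normrM !normrX.
have := ler_pM (normr_ge0 _) (normr_ge0 _) h1 IH2 => h2.
have nn0 : 0 <= n.+1%:Z ^+ 2 * `|xi| ^+ 2 by rewrite mulr_ge0 ?exprn_ge0.
have h3 := ler_wpM2l nn0 IH1.
apply: le_trans (lerD h2 h3) _.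
rewrite !factS !PoszM !exprS expr0 !mulr1 /c; set z := `|xi| in xi1 *.
set A := M * _ * _ in A0.
have -> : M * ((3 * z) * ((3 * z) * (3 * z) ^+ n)) *
    (n.+2%:Z * (n.+1%:Z * n`!%:Z)) =
  9 * z * z * n.+2%:Z * n.+1%:Z * (M * (3 * z) ^+ n * n`!%:Z) by ring.
have -> : (2 * n.+2)%:Z * z * (M * ((3 * z) * (3 * z) ^+ n) * (n.+1%:Z * n`!%:Z))
  = 6 * z * z * n.+2%:Z * n.+1%:Z * (M * (3 * z) ^+ n * n`!%:Z).
  by rewrite PoszM; ring.
rewrite -/c -/A -mulrDl ler_wpM2r//.
have w0 : 0 <= z * z * n.+1%:Z by rewrite !mulr_ge0//; lia.
have -> : n.+2%:Z = n.+1%:Z + 1 by rewrite -addn1 PoszD.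
have := mulr_ge0 w0 (le0z_nat n.+1); move: w0.
by move: (n.+1%:Z) => s; lra.
Qed.

Definition euler_psum K : int := \sum_(j < K) j`!%:Z * xi ^+ j.

Definition pade_coef n j : int := (-1) ^+ n * n`!%:Z * j`!%:Z * 'C(j, n)%:Z.

(* The truncation of the remainder series
   [B_n F - A_n = \sum_j (-1)^n n! j! C(j, n) xi^(n + j)]. *)
Definition pade_rem n K : int := \sum_(j < K) pade_coef n j * xi ^+ (n + j).

(** The recurrence of [pade] read on the coefficients of the remainder series, where the term [- 1]
    without [xi] shifts [j]. It reduces to two instances of
    [(k + 1) C(j, k + 1) = (j - k) C(j, k)]. *)
Lemma pade_coef_rec n j : pade_coef n.+2 j =
  (2 * n.+1 + 1)%:Z * pade_coef n.+1 j - pade_coef n.+1 j.+1 -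
  n.+1%:Z ^+ 2 * pade_coef n j.
Proof.
rewrite /pade_coef binS PoszD !factS !PoszM.
have key k : k.+1%:Z * 'C(j, k.+1)%:Z = (j%:Z - k%:Z) * 'C(j, k)%:Z.
  rewrite -PoszM mul_bin_left; have [kj|jk] := leqP k j.
    by rewrite PoszM subzn.
  by rewrite bin_small// muln0 mulr0.
have k1 := key n; have k2 := key n.+1.
rewrite [(-1) ^+ n.+2]exprS [(-1) ^+ n.+1]exprS.
set s := (-1) ^+ n; move: k1 k2.
have -> : j.+1%:Z = j%:Z + 1 by rewrite -addn1 PoszD.
have -> : n.+2%:Z = n%:Z + 2 by rewrite -addn2 PoszD.
have -> : n.+1%:Z = n%:Z + 1 by rewrite -addn1 PoszD.
rewrite PoszD.
move: (n%:Z) (j%:Z) ('C(j, n)%:Z) ('C(j, n.+1)%:Z) ('C(j, n.+2)%:Z) => a b u v w.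
move: (n`!%:Z) (j`!%:Z) => p q k1 k2.
transitivity (s * (a + 1) * p * q * ((a + 2) * w)); first by ring.
transitivity (s * (a + 1) * p * q * ((b - 2 * a - 2) * v + (b - a) * u));
  last by ring.
by rewrite k2 -k1; ring.
Qed.

Lemma pade_rem_rec n K :
  ((2 * n.+1 + 1)%:Z * xi - 1) * pade_rem n.+1 K -
  n.+1%:Z ^+ 2 * xi ^+ 2 * pade_rem n K - pade_rem n.+2 K =
  pade_coef n.+1 K * xi ^+ (n.+1 + K).
Proof.
elim: K => [|K IH].
  by rewrite /pade_rem !big_ord0 /pade_coef bin0n !mulr0 mul0r subrr.
have step k : pade_rem k K.+1 = pade_rem k K + pade_coef k K * xi ^+ (k + K).
  by rewrite /pade_rem big_ord_recr.
rewrite !step pade_coef_rec (addnS n.+1 K) !(addSn _ K).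
have x1 : xi ^+ (n + K).+1 = xi * xi ^+ (n + K) by rewrite exprS.
have x2 : xi ^+ (n + K).+2 = xi ^+ 2 * xi ^+ (n + K) by rewrite -exprD.
rewrite addSn x1 in IH; rewrite x1 x2.
transitivity (pade_coef n.+1 K.+1 * (xi ^+ 2 * xi ^+ (n + K)) -
    pade_coef n.+1 K * (xi * xi ^+ (n + K)) +
    (((2 * n.+1 + 1)%:Z * xi - 1) * pade_rem n.+1 K -
     n.+1%:Z ^+ 2 * xi ^+ 2 * pade_rem n K - pade_rem n.+2 K)); last first.
  by rewrite IH; ring.
by ring.
Qed.

Lemma pade_rem0 K : pade_rem 0 K = euler_psum K.
Proof.
apply: eq_bigr => j _; rewrite /pade_coef expr0 fact0 bin0 add0n.
by rewrite !mul1r mulr1.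
Qed.

Lemma pade_rem1 K :
  (xi - 1) * euler_psum K + 1 - pade_rem 1 K = K`!%:Z * xi ^+ K.
Proof.
elim: K => [|K IH].
  by rewrite /euler_psum /pade_rem !big_ord0 mulr0 add0r subr0.
have -> : pade_rem 1 K.+1 = pade_rem 1 K + pade_coef 1 K * xi ^+ (1 + K).
  by rewrite /pade_rem big_ord_recr.
have -> : euler_psum K.+1 = euler_psum K + K`!%:Z * xi ^+ K.
  by rewrite /euler_psum big_ord_recr.
move: IH; rewrite /pade_coef bin1 expr1 (_ : 1`! = 1%N)// add1n exprS factS PoszM.
have -> : K.+1%:Z = K%:Z + 1 by rewrite -addn1 PoszD.
move: (pade_rem 1 K) (euler_psum K) => U F; move: (K`!%:Z) (xi ^+ K) => A B e.
have -> : (xi - 1) * (F + A * B) + 1 - (U + -1 * 1 * A * K%:Z * (xi * B)) =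
  ((xi - 1) * F + 1 - U) + (xi - 1) * (A * B) + A * K%:Z * (xi * B) by ring.
by rewrite e; ring.
Qed.

(** Truncation breaks the recurrence only by boundary terms, here and in [pade_rem1], all multiples
    of [K!]. Modulo [K!] both sides thus have the same recurrence and initial values. *)
Lemma pade_rem_congr n K : (K`!%:Z %|
  pade (euler_psum K) ((xi - 1) * euler_psum K + 1) n - pade_rem n K)%Z.
Proof.
set F := euler_psum K; set G := _ + 1.
elim/nat_ind2: n => [||n IH1 IH2].
- by rewrite /= pade_rem0 subrr dvdz0.
- by rewrite /= pade_rem1 dvdz_mulr.
rewrite padeSS; have E := pade_rem_rec n K.
have -> : ((2 * n.+1 + 1)%:Z * xi - 1) * pade F G n.+1 -
   n.+1%:Z ^+ 2 * xi ^+ 2 * pade F G n - pade_rem n.+2 K =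
   ((2 * n.+1 + 1)%:Z * xi - 1) * (pade F G n.+1 - pade_rem n.+1 K) -
   n.+1%:Z ^+ 2 * xi ^+ 2 * (pade F G n - pade_rem n K) +
   pade_coef n.+1 K * xi ^+ (n.+1 + K).
  by rewrite -E; ring.
apply: rpredD; first by rewrite rpredB// dvdz_mull.
by rewrite dvdz_mulr// /pade_coef mulrAC dvdz_mull.
Qed.

(** One factor [n!] is explicit; the other divides [j!] when [n <= j], and [C(j, n)] vanishes
    otherwise. *)
Lemma pade_rem_dvd n K : ((n`! ^ 2)%N%:Z %| pade_rem n K)%Z.
Proof.
apply: rpred_sum => j _; rewrite dvdz_mulr// /pade_coef -!mulrA dvdz_mull//.
have [jn|nj] := ltnP j n; first by rewrite bin_small// !mulr0 dvdz0.
rewrite -!PoszM dvdzE !absz_nat.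
by rewrite -mulnn dvdn_mul// dvdn_mulr// -(bin_fact nj) dvdn_mull// dvdn_mulr.
Qed.

(** For the approximants [A], [B] and the partial sum [F], [a B - b A = b (B F - A) - B (b F - a)],
    and [d] divides both terms on the right. *)
Lemma pade_form_dvd d a b n K : (d %| b * euler_psum K - a)%Z ->
  (d %| K`!%:Z)%Z -> (d %| (n`! ^ 2)%N%:Z)%Z ->
  (d %| pade a (a * (xi - 1) + b) n)%Z.
Proof.
move=> d1 d2 d3; set F := euler_psum K in d1; set G := (xi - 1) * F + 1.
have e : pade (b * F - a) (b * G - (a * (xi - 1) + b)) n =
    b * pade F G n - pade a (a * (xi - 1) + b) n by exact: pade_linear.
have h1 : (d %| pade (b * F - a) (b * G - (a * (xi - 1) + b)) n)%Z.
  apply: pade_dvd => //.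
  have -> : b * G - (a * (xi - 1) + b) = (xi - 1) * (b * F - a).
    by rewrite /G; ring.
  exact: dvdz_mull.
have h2 : (d %| pade F G n)%Z.
  rewrite -[pade _ _ _](subrK (pade_rem n K)) rpredD//.
    exact: dvdz_trans d2 (pade_rem_congr n K).
  exact: dvdz_trans d3 (pade_rem_dvd n K).
have -> : pade a (a * (xi - 1) + b) n = b * pade F G n -
    pade (b * F - a) (b * G - (a * (xi - 1) + b)) n by rewrite e; ring.
by rewrite rpredB// dvdz_mull.
Qed.

End Pade.

(** * From p-adic sums to congruences between integers *)

Section PadicLimit.
Variable p : nat.
Hypothesis p_pr : prime p.

Lemma Qp_abs_int (n : int) : Qp_abs (n%:~R : Qp p) = padic_abs p n%:~R.
Proof. by rewrite -Qp_abs_ratr ratr_int. Qed.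

Lemma padic_abs_int_le1 (n : int) : padic_abs p n%:~R <= 1.
Proof.
have [->|n0] := eqVneq n 0; first by rewrite padic_abs0.
by rewrite padic_abs_intE// invf_le1 ?exprn_ege1 ?exprn_gt0 ?ler1n ?ltr0n ?prime_gt0.
Qed.

Lemma padic_abs_int_dvd (n : int) e : padic_abs p n%:~R < (p%:Q ^+ e)^-1 ->
  ((p ^ e)%N%:Z %| n)%Z.
Proof.
have [->|n0] := eqVneq n 0; first by rewrite dvdz0.
have p1 : 1 < p%:Q by rewrite ltr1n prime_gt1.
have p0 : 0 < p%:Q by exact: lt_trans p1.
rewrite padic_abs_intE// ltf_pV2 ?posrE ?exprn_gt0// ltr_eXn2l// => en.
by rewrite dvdzE absz_nat pfactor_dvdn ?absz_gt0// ltnW.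
Qed.

Lemma euler_psum_congr (xi a b : int) e :
  Lambda a b (euler_series (xi%:~R : Qp p)) = 0 ->
  exists K, ((p ^ e)%N%:Z %| b * euler_psum xi K - a)%Z /\
    ((p ^ e)%N%:Z %| K`!%:Z)%Z.
Proof.
rewrite /Lambda; set S := euler_series _ => /eqP; rewrite subr_eq0 => /eqP aS.
have p0 : 0 < p%:Q by rewrite ltr0n prime_gt0.
have xi1 : Qp_abs (xi%:~R : Qp p) <= 1 by rewrite Qp_abs_int padic_abs_int_le1.
have cS : series (fun n => (n`!)%:R * (xi%:~R : Qp p) ^+ n) @ \oo --> S.
  exact: euler_series_cvg.
have e0 : 0 < (p%:Q ^+ e)^-1 by rewrite invr_gt0 exprn_gt0.
have /cvg_ballP/(_ _ e0)[N _ hN] := cS.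
(* From [N] on, partial sums are within [p ^ (- e)] of the limit; [K >= p ^ e] makes [p ^ e] divide
   [K!]. *)
pose K := maxn N (p ^ e); exists K; split; last first.
  rewrite dvdzE !absz_nat dvdn_fact// leq_maxr expn_gt0 prime_gt0//.
apply: padic_abs_int_dvd; rewrite -Qp_abs_int -Qp_absN -rmorphN opprB rmorphB.
rewrite rmorphM /= aS.
have -> : (euler_psum xi K)%:~R =
    series (fun n => (n`!)%:R * (xi%:~R : Qp p) ^+ n) K.
  rewrite /euler_psum rmorph_sum /series /= big_mkord.
  by apply: eq_bigr => j _; rewrite rmorphM rmorphXn /=.
rewrite -mulrBr Qp_absM.
have := hN K (leq_maxl _ _); rewrite Qp_ballE /=; apply: le_lt_trans.
by rewrite ler_piMl ?Qp_abs_ge0// Qp_abs_int padic_abs_int_le1.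
Qed.

End PadicLimit.

(** * Comparison of sizes *)

Section Assembly.
Variable T : realType.

Lemma sum_cop_totient m : \sum_(i < m) cop T m i = (totient m)%:R.
Proof.
rewrite totient_count_coprime natr_sum big_mkord; apply: eq_bigr => i _.
by rewrite /cop coprime_sym.
Qed.

(** Subtracting from the indicator of [P] its density times [cop] leaves a balanced function, whose
    sum is bounded; [mertens_coprime] then gives the main term, and non-primes cost at most 2. *)
Lemma sum_prime_ln_ge (m : nat) (P : pred nat) : (1 < m)%N ->
  (forall n, P (n + m)%N = P n) -> (forall n, P n -> coprime n m) ->
  exists C : T, forall N, (0 < N)%N ->
    (\sum_(i < m) (P i)%:R) / (totient m)%:R * ln N%:R - C <=
    \sum_(1 <= p < N.+1 | prime p && P p) ln p%:R / p%:R.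
Proof.
move=> m1 Pm Pc; set kap := _ / _.
have m0 : (0 < m)%N by exact: ltnW.
pose t n : T := (P n)%:R - kap * cop T m n.
have t_bal : balanced m t.
  split=> [n|n nm|].
  - by rewrite /t Pm cop_periodic.
  - rewrite /t /cop (negbTE nm) mulr0 subr0.
    by case: (boolP (P n)) nm => // /Pc ->.
  - rewrite sumrB -mulr_sumr sum_cop_totient /kap divfK ?subrr//.
    by rewrite pnatr_eq0 -lt0n totient_gt0.
have [C1 h1] := sum_mangoldt_balanced m1 t_bal.
have [C2 h2] := mertens_coprime T m0.
exists (C1 + kap * C2 + 2) => N N0.
have kap0 : 0 <= kap by rewrite divr_ge0// sumr_ge0.
have t0 n : 0 <= mangoldt T n / n%:R by rewrite divr_ge0 ?mangoldt_ge0.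
have := h1 N; have := h2 N N0; have := sum_mangoldt_nonprime T N.
set Q := \sum_(_ <= _ < _ | _) _.
set S := \sum_(1 <= n < N.+1) mangoldt T n / n%:R * (coprime n m)%:R.
have -> : \sum_(1 <= n < N.+1) mangoldt T n / n%:R * t n =
   \sum_(1 <= n < N.+1) mangoldt T n / n%:R * (P n)%:R - kap * S.
  by rewrite /S mulr_sumr -sumrB; apply: eq_bigr => n _; rewrite /t /cop; ring.
set A := \sum_(1 <= n < N.+1) mangoldt T n / n%:R * (P n)%:R.
set B := \sum_(1 <= p < N.+1 | prime p && P p) _.
have AB : A <= B + Q.
  rewrite /A /B /Q [X in _ <= X + _]big_mkcond [X in _ <= _ + X]big_mkcond.
  rewrite -big_split; apply: ler_sum_nat => n _ /=.
  case: (boolP (prime n)) => pn /=; case: (P n) => /=;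
    rewrite ?mulr1 ?mulr0 ?addr0 ?add0r//.
  by rewrite mangoldt_prime.
move=> Q2; rewrite !ler_norml => /andP[a1 a2] /andP[b1 b2].
have := ler_wpM2l kap0 a1; lra.
Qed.

Lemma dvdn_prod_pfactor (s : seq nat) (e : nat -> nat) x : uniq s ->
  {in s, forall p, prime p /\ (p ^ e p %| x)%N} ->
  (\prod_(p <- s) p ^ e p %| x)%N.
Proof.
elim: s => [|p s IH] /=; first by rewrite big_nil.
move=> /andP[ps us] h; rewrite big_cons Gauss_dvd.
  rewrite (h p (mem_head _ _)).2 IH// => q qs.
  by apply: h; rewrite inE qs orbT.
rewrite big_seq; apply: (big_ind (fun y => coprime (p ^ e p) y)) => [|x1 x2 c1 c2|q qs].
- exact: coprimen1.
- by rewrite coprimeMr c1 c2.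
have [pp _] := h p (mem_head _ _).
have qs' : q \in p :: s by rewrite inE qs orbT.
have [qq _] := h q qs'.
rewrite coprimeXl// coprimeXr// prime_coprime// dvdn_prime2//.
by apply: contra ps => /eqP ->.
Qed.

(** The first term of Legendre's formula gives [logn p N! >= N %/ p > N / p - 1]; the losses [ln p]
    sum to at most [psi N]. *)
Lemma ln_absz_ge (x : int) (P : pred nat) N : x != 0 ->
  (forall p, prime p -> P p -> (p ^ (2 * logn p N`!) %| `|x|)%N) ->
  2 * (N%:R * (\sum_(1 <= p < N.+1 | prime p && P p) ln p%:R / p%:R) -
    psi T N) <= ln `|x|%N%:R.
Proof.
move=> x0 h; pose s := [seq p <- index_iota 1 N.+1 | prime p && P p].
pose e p := (2 * logn p N`!)%N.
have sp p : p \in s -> [/\ prime p, P p & (p <= N)%N].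
  by rewrite mem_filter mem_index_iota ltnS => /andP[/andP[-> ->] /andP[_ ->]].
have dv : (\prod_(p <- s) p ^ e p %| `|x|)%N.
  apply: dvdn_prod_pfactor; first by rewrite filter_uniq// iota_uniq.
  by move=> p /sp[pp Pp _]; split=> //; exact: h.
have p0 : (0 < \prod_(p <- s) p ^ e p)%N.
  rewrite big_seq prodn_cond_gt0// => p /sp[pp _ _].
  by rewrite expn_gt0 prime_gt0.
apply: (@le_trans _ _ (ln (\prod_(p <- s) p ^ e p)%:R)); last first.
  by rewrite ler_ln_nat// dvdn_leq// absz_gt0.
have -> : ln (\prod_(p <- s) p ^ e p)%:R = \sum_(p <- s) ln p%:R *+ e p :> T.
  elim: (s) (sp) => [|p s' IH] sp'; first by rewrite !big_nil ln1.
  have [pp _ _] := sp' p (mem_head _ _).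
  have pgt0 := prime_gt0 pp.
  have q0 : (0 < \prod_(q <- s') q ^ e q)%N.
    rewrite big_seq prodn_cond_gt0// => q qs.
    have qs' : q \in p :: s' by rewrite inE qs orbT.
    by have [qq _ _] := sp' q qs'; rewrite expn_gt0 prime_gt0.
  rewrite !big_cons natrM lnM ?posrE ?ltr0n ?expn_gt0 ?pgt0//.
  rewrite natrX lnXn ?ltr0n// IH// => q qs.
  by apply: sp'; rewrite inE qs orbT.
have psiE : \sum_(p <- s) ln p%:R <= psi T N.
  rewrite /psi big_filter big_mkcond; apply: ler_sum_nat => n _.
  case: ifP => [/andP[pn _]|_]; last exact: mangoldt_ge0.
  by rewrite mangoldt_prime.
apply: (@le_trans _ _ (2 * (N%:R * (\sum_(p <- s) ln p%:R / p%:R) -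
    \sum_(p <- s) ln p%:R))).
  by rewrite ler_wpM2l// -big_filter -/s lerD2l lerN2.
rewrite mulr_sumr -sumrB mulr_sumr big_seq [leRHS]big_seq.
apply: ler_sum => p /sp[pp _ pN].
have p0' : (0 < p)%N := prime_gt0 pp.
have v : (N %/ p <= logn p N`!)%N.
  rewrite logn_fact//; case: N pN {h s e sp dv p0 psiE} => [|N] pN.
    by rewrite leqNgt p0' in pN.
  by rewrite big_ltn// expn1 leq_addr.
have := ltr_divnS T N p0'; rewrite -natr1 => h1.
have h2 : N%:R / p%:R - 1 <= (logn p N`!)%:R :> T.
  by move: v; rewrite -(ler_nat T); lra.
rewrite -[leRHS]mulr_natl /e natrM.
have := ler_wpM2r (ln_nat_ge0 T p) h2.
have -> : (N%:R / p%:R - 1) * ln p%:R = N%:R * (ln p%:R / p%:R) - ln p%:R :> T.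
  by ring.
by lra.
Qed.

(* The contradiction: a nonzero [pade a _ n] of logarithmic size
   [n * ln n + O(n)] would be divisible by the prime-to-exceptions part of
   [n! ^ 2] over the primes of [P], of size [2 kap n * ln n + O(n)]. *)
Lemma pade_density_bound (xi a b : int) (m : nat) (P : pred nat) X :
  xi != 0 -> b != 0 -> (1 < m)%N ->
  (forall n, P (n + m)%N = P n) -> (forall n, P n -> coprime n m) ->
  (forall p, prime p -> P p -> (X < p)%N ->
    Lambda a b (euler_series (xi%:~R : Qp p)) = 0) ->
  2 * (\sum_(i < m) (P i)%:R) / (totient m)%:R - 1 <= 0 :> T.
Proof.
move=> xi0 b0 m1 Pm Pc hL.
have [C hC] := sum_prime_ln_ge m1 Pm Pc.
rewrite -mulrA; set kap := _ / _ in hC *.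
pose D n := pade xi a (a * (xi - 1) + b) n.
pose M : int := `|a| + `|a * (xi - 1) + b|.
have ab0 : (a != 0) || (a * (xi - 1) + b != 0).
  by case: eqVneq => //= ->; rewrite mul0r add0r.
have M1 : 1 <= M.
  rewrite -gtz0_ge1 /M; case/orP: ab0 => h.
    by rewrite ltr_pwDl ?normr_gt0.
  by rewrite ltr_wpDl ?normr_gt0.
(* This absorbs the primes up to [X], where nothing is assumed. *)
pose E : T := \sum_(1 <= p < X.+1) ln p%:R / p%:R.
have t0 p : 0 <= ln p%:R / p%:R :> T by rewrite divr_ge0 ?ln_nat_ge0.
have E0 : 0 <= E by exact: sumr_ge0.
(* The 8 is twice the constant of [psi_le]; the last two terms come from [pade_bound]. *)
pose K : T := 2 * (C + E) + 8 + ln `|M|%N%:R + ln (3 * `|xi|%N)%:R.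
have key n : (0 < n)%N -> D n != 0 -> (2 * kap - 1) * ln n%:R <= K.
  move=> n0 Dn; pose P' p := P p && (X < p)%N.
  have dv p : prime p -> P' p -> (p ^ (2 * logn p n`!) %| `|D n|)%N.
    move=> pp /andP[Pp Xp].
    have [k [k1 k2]] := euler_psum_congr pp (2 * logn p n`!) (hL p pp Pp Xp).
    have := pade_form_dvd (n := n) k1 k2; rewrite !dvdzE !absz_nat; apply.
    by rewrite mulnC expnM dvdn_exp2r// pfactor_dvdnn.
  have low := ln_absz_ge Dn dv.
  have up : ln `|D n|%N%:R <=
      ln `|M|%N%:R + n%:R * ln (3 * `|xi|%N)%:R + n%:R * ln n%:R :> T.
    have := pade_bound n xi0 (_ : `|a| <= M) (_ : `|a * (xi - 1) + b| <= M).
    rewrite lerDl lerDr => /(_ (normr_ge0 _) (normr_ge0 _)) hb.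
    have hb' : (`|D n| <= `|M| * (3 * `|xi|) ^ n * n`!)%N.
      rewrite -lez_nat !PoszM; move: hb; rewrite abszE.
      rewrite (_ : (`|M|%N : int) = M); last by rewrite abszE ger0_norm//; lia.
      by rewrite -[Posz (_ ^ _)]natz natrX natz PoszM abszE.
    have M0 : (0 < `|M|)%N by rewrite absz_gt0; lia.
    have x0 : (0 < 3 * `|xi|)%N by rewrite muln_gt0 absz_gt0.
    apply: (@le_trans _ _ (ln (`|M| * (3 * `|xi|) ^ n * n`!)%N%:R)).
      by rewrite ler_ln_nat// absz_gt0.
    move: (3 * `|xi|)%N x0 (`|M|%N) M0 => c c0 M' M0.
    rewrite !natrM natrX !lnM ?posrE ?mulr_gt0 ?exprn_gt0 ?ltr0n ?fact_gt0//.
    by rewrite lnXn ?ltr0n// -[ln _ *+ n]mulr_natl lerD2l ln_fact_le.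
  have PP' : \sum_(1 <= p < n.+1 | prime p && P p) ln p%:R / p%:R <=
     \sum_(1 <= p < n.+1 | prime p && P' p) ln p%:R / p%:R + E.
    have -> : E = \sum_(1 <= p < (maxn X n).+1)
        (if (p <= X)%N then ln p%:R / p%:R else 0).
      rewrite [RHS](big_cat_nat (n := X.+1)) ?ltnS ?leq_maxl//=.
      rewrite [X in _ = _ + X]big_nat [X in _ = _ + X]big1 ?addr0//; last first.
        by move=> p /andP[Xp _]; rewrite leqNgt Xp.
      by apply: eq_big_nat => p /andP[_]; rewrite ltnS => ->.
    rewrite [X in _ <= _ + X](big_cat_nat (n := n.+1)) ?ltnS ?leq_maxr//= addrA.
    rewrite -[leLHS]addr0 lerD//; last first.
      by rewrite sumr_ge0// => p _; case: ifP.
    rewrite big_mkcond [X in _ <= X + _]big_mkcond -big_split.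
    apply: ler_sum_nat => p _; rewrite /P' /=.
    case: (prime p) => /=; last by rewrite add0r; case: ifP.
    case: (P p) => /=; last by rewrite add0r; case: ifP.
    by case: ltnP => pX; rewrite ?addr0 ?add0r.
  have n1 : 1 <= n%:R :> T by rewrite ler1n.
  have n0' : 0 < n%:R :> T by rewrite ltr0n.
  have lM : ln `|M|%N%:R <= n%:R * ln `|M|%N%:R :> T.
    by rewrite ler_peMl// ln_nat_ge0.
  have := ler_wpM2l (ltW n0') (le_trans (hC n n0) PP').
  have := psi_le T n.
  move: low up; set Y := \sum_(_ <= _ < _ | _) _ => low up ps hh.
  rewrite -(ler_pM2l n0') /K.
  by move: low up ps hh lM; lra.
rewrite leNgt; apply/negP => kap0; move: (kap0); rewrite ltNge => /negP; apply.
apply: (@ln_mul_bounded _ _ K) => N N0.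
(* When only [D N.+1] is known to be nonzero, [ln N <= ln (N + 1)] and the assumed positivity of
   [2 * kap - 1] bring the bound back to [N]. *)
have [D0|D0] := orP (pade_neq0 N xi0 ab0); first exact: key.
apply: le_trans (key N.+1 isT D0); rewrite ler_wpM2l ?ler_ln_nat//.
exact: ltW.
Qed.

End Assembly.

(** * Residue classes and the conclusion *)

Lemma residue_class_eq m h x :
  residue_class m h x -> residue_class m h = residue_class m x.
Proof.
move=> [k _ <-]; apply/seteqP; split=> y [l _ <-].
  by exists (l - k) => //; ring.
by exists (l + k) => //; ring.
Qed.

Lemma residue_class_coprime m h (n : nat) :
  coprimez h m%:Z -> residue_class m h n%:Z -> coprime n m.
Proof.
move=> hm [k _ e]; have : coprimez n%:Z m%:Z.
  by rewrite -e /coprimez gcdzC addrC gcdzMDl gcdzC.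
by rewrite coprimezE !absz_nat.
Qed.

Lemma finite_set_nat_bound (A : set nat) : finite_set A ->
  exists X, forall n, A n -> (n <= X)%N.
Proof.
move=> /finite_seqP[s ->]; exists (\max_(i <- s) i) => n ns.
by apply: leq_bigmax_seq.
Qed.

From mathcomp Require Import Rstruct.

Theorem theorem3 (xi a b : int) (hxi : xi != 0) (hb : b != 0)
  (m : nat) (hm : (3 <= m)%N)
  (abar : 'I_(totient m) -> set int)
  (habar : set_bij [set: 'I_(totient m)] (reduced_residue_system m) abar)
  (r : nat) (hr : (totient m)%:R / 2 < r%:R :> rat)
  (idx : 'I_r -> 'I_(totient m)) (hidx : injective idx)
  (R : set nat)
  (hR : R = \bigcup_(j in [set: 'I_r])
              [set p : nat | abar (idx j) p%:Z /\ prime p]) :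
  infinite_set
    [set p : nat | R p /\ Lambda a b (euler_series (xi%:~R : Qp p)) != 0].
Proof.
move=> /finite_set_nat_bound[X hX].
have m_gt1 : (1 < m)%N by exact: ltnW.
have m_gt0 : (0 < m)%N by exact: ltnW.
have [abar_sub abar_inj _] := habar.
pose P (n : nat) := `[< exists j, abar (idx j) n%:Z >].
have classP i : exists2 h, coprimez h m%:Z & abar i = residue_class m h.
  by have [h hc <-] := abar_sub i I; exists h.
have Pc n : P n -> coprime n m.
  move=> /asboolP[j]; have [h hc ->] := classP (idx j).
  exact: residue_class_coprime.
have Pm n : P (n + m)%N = P n.
  apply: asbool_equiv_eq; split=> -[j]; have [h _ e] := classP (idx j);
    rewrite e => -[k _ hk]; exists j; rewrite e.
    by exists (k - 1) => //; rewrite mulrBl mul1r addrA hk PoszD addrK.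
  by exists (k + 1) => //; rewrite mulrDl mul1r addrA hk PoszD.
(* A prime of [R] beyond [X] lies outside the set assumed finite. *)
have hL p : prime p -> P p -> (X < p)%N ->
    Lambda a b (euler_series (xi%:~R : Qp p)) = 0.
  move=> pp /asboolP[j jp] Xp; apply/eqP/negPn/negP => L0.
  have := hX p; rewrite leqNgt Xp /=; case/(_ _)/notF; split=> //.
  by rewrite hR; exists j.
(* Distinct chosen classes have distinct representatives below [m], so the density of [P] among
   reduced residues is at least [r / totient m > 1 / 2]. *)
have rep j : exists i : 'I_m, abar (idx j) (val i)%:Z.
  have [h _ ->] := classP (idx j).
  have hm0 : 0 <= (h %% m%:Z)%Z by rewrite modz_ge0// eqz_nat -lt0n.
  have lt : (`|(h %% m%:Z)%Z| < m)%N.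
    by rewrite -ltz_nat gez0_abs// ltz_pmod// ltz_nat.
  exists (Ordinal lt) => /=; rewrite gez0_abs//.
  by exists (- (h %/ m%:Z)%Z) => //; rewrite {1}(divz_eq h m%:Z); ring.
pose rho j := projT1 (cid (rep j)).
have rhoP j : abar (idx j) (val (rho j))%:Z := projT2 (cid (rep j)).
have rho_inj : injective rho.
  move=> i j ij; apply: hidx; apply: abar_inj; rewrite ?in_setT//.
  have := rhoP i; have := rhoP j; rewrite ij.
  have [h _ ->] := classP (idx i); have [h' _ ->] := classP (idx j).
  by move=> /residue_class_eq -> /residue_class_eq ->.
have count : (r <= \sum_(i < m) P i)%N.
  rewrite -[r]card_ord -(card_imset _ rho_inj) -sum1_card.
  rewrite big_mkcond leq_sum// => i _; case: ifP => // /imsetP[j _ ->].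
  by rewrite (_ : P _ = true)//; apply/asboolP; exists j.
have := @pade_density_bound Rdefinitions.R xi a b m P X hxi hb m_gt1 Pm Pc hL.
apply/negP; rewrite -ltNge subr_gt0.
have t0 : (0 < totient m)%N by rewrite totient_gt0.
rewrite ltr_pdivlMr ?ltr0n// mul1r -natr_sum -natrM ltr_nat.
move: hr; rewrite ltr_pdivrMr// -natrM ltr_nat => hr'.
by rewrite (leq_trans hr')// mulnC leq_mul2l.
Qed.
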